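(* There exists a number $n_0$ such that the following holds. Suppose $G$ is a fascinating graph with $n\ge n_0$ vertices and $m$ edges, where $m>\frac{1}{4}(n^2+2n+17)$. Then $G$ is a graph join of two cycles.
   Context: For a graph $G$ and a vertex $v$, $N_v=\{w: vw\in E(G)\}$. For a clique $\sigma$ in $G$, the link $\mathrm{lk}_G\sigma$ is the subgraph of $G$ induced by $\bigcap_{v\in\sigma}N_v$ (the vertices not in $\sigma$ adjacent to every vertex of $\sigma$). The length of a cycle is its number of vertices. A graph $G$ with $n$ vertices and $m$ edges is fascinating if: (a) $G$ contains exactly $2(m-n)$ triangles; (b) for every edge $e$ of $G$, $\mathrm{lk}_G e$ is a cycle of length at least $4$; (c) for every triangle $t$ of $G$, $\mathrm{lk}_G t$ is the graph with exactly $2$ vertices and no edges; (d) for every vertex $v$ of $G$, $\mathrm{lk}_G v$ is a connected planar graph whose every face (including the unbounded one) is a triangle, and $\mathrm{lk}_G v$ has at least $6$ vertices. The graph join $G\ast H$ of two graphs is their disjoint union together with all edges between $V(G)$ and $V(H)$. *)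

(* Defs.v *)
From HB Require Import structures.
From mathcomp Require Import all_boot all_order all_algebra.
From mathcomp Require Import classical_sets boolp reals topology normedtype.

Set Implicit Arguments.
Unset Strict Implicit.
Unset Printing Implicit Defensive.
Import Order.TTheory GRing.Theory Num.Theory.
Import numFieldNormedType.Exports.

Record sgraph := SGraph {
  vertex :> finType;
  adj : rel vertex;
  adj_sym : symmetric adj;
  adj_irr : irreflexive adj }.

Section SimpleGraphs.
Implicit Types G H : sgraph.

Definition edges G : {set {set G}} :=
  [set e : {set G} | [exists x, exists y, adj x y && (e == [set x; y]%SET)]]%SET.

Definition clique G (s : {set G}) : bool :=
  [forall x in s, forall y in s, (x != y) ==> adj x y].

Definition triangles G : {set {set G}} :=
  [set t : {set G} | (#|t| == 3) && clique t]%SET.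

Definition graph_iso G H : Prop :=
  exists2 f : G -> H, bijective f & forall x y, adj (f x) (f y) = adj x y.

Definition connected_graph G : Prop := forall x y : G, connect (@adj G) x y.

Definition induced G (S : {set G}) : sgraph :=
  @SGraph {x : G | x \in S} (fun x y => adj (val x) (val y))
    (fun x y => adj_sym (val x) (val y)) (fun x => adj_irr (val x)).

Definition link G (s : {set G}) : sgraph :=
  induced [set w : G | [forall v in s, adj v w]]%SET.

Section CycleGraph.
Variable k : nat.

Definition cycle_adj : rel 'I_k :=
  fun i j => (i != j) && ((j == ordS i) || (i == ordS j)).

Lemma cycle_adj_sym : symmetric cycle_adj.
Proof. by move=> i j; rewrite /cycle_adj eq_sym orbC. Qed.

Lemma cycle_adj_irr : irreflexive cycle_adj.
Proof. by move=> i; rewrite /cycle_adj eqxx. Qed.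

Definition cycle_graph : sgraph := SGraph cycle_adj_sym cycle_adj_irr.
End CycleGraph.

(* [cycle_graph k] is degenerate for k < 3. *)
Definition is_cycle_of_length (k : nat) H : Prop :=
  3 <= k /\ graph_iso H (cycle_graph k).

Definition is_cycle H : Prop := exists k, is_cycle_of_length k H.

Section Join.
Variables G H : sgraph.

Definition join_adj : rel (G + H) := fun u v =>
  match u, v with
  | inl x, inl y => adj x y
  | inr x, inr y => adj x y
  | _, _ => true
  end.

Lemma join_adj_sym : symmetric join_adj.
Proof. by move=> [x|x] [y|y] //=; rewrite adj_sym. Qed.

Lemma join_adj_irr : irreflexive join_adj.
Proof. by move=> [x|x] /=; rewrite adj_irr. Qed.

Definition graph_join : sgraph := SGraph join_adj_sym join_adj_irr.
End Join.

End SimpleGraphs.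

Section PlaneGraphs.
Local Open Scope classical_set_scope.
Local Open Scope ring_scope.
Variable R : realType.

Definition plane : topologicalType := (R * R)%type.

Definition is_arc (p q : plane) (A : set plane) : Prop :=
  exists gamma : R -> plane,
    [/\ {within `[0, 1], continuous gamma},
        {in `[0, 1] &, injective gamma},
        gamma 0 = p, gamma 1 = q &
        A = gamma @` `[0, 1]].

Record drawing (G : sgraph) := Drawing {
  pos : G -> plane;
  arc : {set G} -> set plane;
  pos_inj : injective pos;
  arcP : forall x y : G, adj x y -> is_arc (pos x) (pos y) (arc [set x; y]%SET);
  arc_vertex : forall (e : {set G}) (z : G),
    e \in edges G -> arc e (pos z) -> z \in e;
  arc_cross : forall (e f : {set G}) (p : plane),
    e \in edges G -> f \in edges G -> e != f -> arc e p -> arc f p ->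
    exists z : G, p = pos z }.

Definition drawn_edges G (D : drawing G) (S : {set {set G}}) : set plane :=
  \bigcup_(e in [set` S]) arc D e.

Definition drawn G (D : drawing G) : set plane :=
  range (pos D) `|` drawn_edges D (edges G).

Definition face G (D : drawing G) (F : set plane) : Prop :=
  exists2 p, ~ drawn D p & F = connected_component (~` drawn D) p.

Definition frontier (A : set plane) : set plane := closure A `&` closure (~` A).

(* The face F is bounded by the drawing of some 3-cycle of the graph. *)
Definition triangular_face G (D : drawing G) (F : set plane) : Prop :=
  exists2 t : {set G}, t \in triangles G &
    frontier F = drawn_edges D [set e in edges G | e \subset t]%SET.

Definition planar_all_faces_triangles (G : sgraph) : Prop :=
  exists D : drawing G, forall F, face D F -> triangular_face D F.

(* The count in the first clause is taken in int, where subtraction is not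
   truncated. *)
Definition fascinating (G : sgraph) : Prop :=
  [/\ #|triangles G|%:Z = 2 * (#|edges G|%:Z - #|G|%:Z),
      forall e, e \in edges G ->
        exists2 k, (4 <= k)%N & is_cycle_of_length k (link e),
      forall t, t \in triangles G ->
        #|link t| = 2%N /\ (forall x y : link t, ~~ adj x y) &
      forall v : G,
        [/\ connected_graph (link [set v]%SET),
            planar_all_faces_triangles (link [set v]%SET) &
            (6 <= #|link [set v]%SET|)%N] ].

End PlaneGraphs.

(* Main.v *)
(* Write N x for the neighbourhood of x and L x y for N x :&: N y.  The links of
   the vertices are connected closed triangulated surfaces, Euler's inequality (rank of boundary matrices over F_2) gives each
   of them at least 3 d - 6 edges, and the number of triangles of G forces
   equality everywhere.  Summing degrees over all K4's (every triangle lies in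
   exactly two) then gives a K4 abcd whose degrees sum to at least 2n + 5, and
   counting edges according to the traces of their ends on abcd shows that, up
   to relabelling, the disjoint cycles L a b and L c d miss at most 49 vertices.
   Extend them to a partition A, B of the vertices.  The number of edges leaves
   only about n/2 nonadjacent pairs across (A, B).  Adjacency between vertices
   without extra neighbours on their own side spreads along both cycles, because
   the links of edges have length at least 4; an averaging argument then
   produces a K4 for which at most one vertex z is missed.  If there is none, the
   two cycles are completely joined.  Otherwise the link of z costs enough
   pairs between the cycles to contradict the lower bound on the number of
   edges. *)
Require Import Defs.
From mathcomp Require Import all_boot all_order all_algebra.
From mathcomp Require Import reals zify lra.

Set Implicit Arguments.
Unset Strict Implicit.
Unset Printing Implicit Defensive.

(** * Links of a fascinating graph in terms of neighbourhoods *)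

Definition nbh (G : sgraph) (x : G) : {set G} := [set y | adj x y].

Local Notation N := nbh.
Local Notation L x y := (nbh x :&: nbh y).

(** Connectedness is used in this form: a nonempty subset closed under adjacency inside a link is
    the whole link. *)
Definition adj_closed (G : sgraph) (S T : {set G}) : Prop :=
  forall x y, x \in S -> y \in T -> adj x y -> y \in S.

(** The triangle count is rearranged to avoid subtraction. [edge_link_cycle] records adjacencies
    along the cycle; the absence of chords is contained in [triangle_link], as the neighbours of [z]
    in [L x y] form the link of the triangle [x y z]. *)
Record spherical_links (G : sgraph) : Prop := SphericalLinks {
  triangle_count : #|triangles G| + 2 * #|G| = 2 * #|edges G|;
  edge_link_ge4 : forall x y : G, adj x y -> 4 <= #|L x y|;
  edge_link_cycle : forall x y : G, adj x y ->
    exists k (f : 'I_k -> G),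
      [/\ injective f, [set f i | i : 'I_k] = L x y
        & forall i, adj (f i) (f (ordS i))];
  triangle_link : forall x y z : G, adj x y -> adj x z -> adj y z ->
    #|L x y :&: N z| = 2;
  no_K5 : forall x y z u v : G, adj x y -> adj x z -> adj y z ->
    u \in L x y :&: N z -> v \in L x y :&: N z -> ~~ adj u v;
  vertex_link_connected : forall (x : G) (S : {set G}),
    S \subset N x -> S != set0 -> adj_closed S (N x) -> S = N x;
  degree_ge6 : forall x : G, 6 <= #|N x| }.

Section Translation.
Variable G : sgraph.
Implicit Types x y z v : G.

Lemma in_nbh x y : (y \in N x) = adj x y.
Proof. by rewrite inE. Qed.

Lemma in_L x y z : (z \in L x y) = adj x z && adj y z.
Proof. by rewrite !inE. Qed.

Lemma adj_neq x y : adj x y -> x != y.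
Proof. by apply: contraTneq => ->; rewrite adj_irr. Qed.

Lemma edgesP x y : adj x y -> [set x; y] \in edges G.
Proof.
by move=> xy; rewrite inE; apply/existsP; exists x; apply/existsP; exists y; rewrite xy eqxx.
Qed.

Lemma edges_exP (e : {set G}) :
  e \in edges G -> exists x y, adj x y /\ e = [set x; y].
Proof. by rewrite inE => /existsP[x /existsP[y /andP[xy /eqP->]]]; exists x, y. Qed.

Lemma card_set3 x y z : x != y -> x != z -> y != z -> #|[set x; y; z]| = 3.
Proof. by move=> xy xz yz; rewrite setUC cardsU1 cards2 !inE xy eq_sym (negPf xz) eq_sym (negPf yz). Qed.

Lemma trianglesP x y z : adj x y -> adj x z -> adj y z ->
  [set x; y; z] \in triangles G.
Proof.
move=> xy xz yz; rewrite inE card_set3 ?adj_neq //=.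
apply/forallP=> u; apply/implyP=> uS; apply/forallP=> v; apply/implyP=> vS.
by apply/implyP; move: uS vS; rewrite !inE => /orP[/orP[]|] /eqP-> /orP[/orP[]|] /eqP->;
  rewrite ?eqxx // ?xy ?xz ?yz // adj_sym ?xy ?xz ?yz.
Qed.

Lemma triangles_exP (t : {set G}) v : t \in triangles G -> v \in t ->
  exists x y, [/\ adj v x, adj v y, adj x y & t = v |: [set x; y]].
Proof.
rewrite inE => /andP[/eqP t3 /forall_inP cl] vt.
have cl' x y : x \in t -> y \in t -> x != y -> adj x y.
  by move=> xt yt; apply/implyP; move: y yt; apply/forall_inP/cl.
have t2 : #|t :\ v| == 2 by have := cardsD1 v t; rewrite vt t3 => /eqP; rewrite eqSS eq_sym.
have /cards2P[x [y [xy tE]]] := t2.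
have /setD1P[xv xt] : x \in t :\ v by rewrite tE !inE eqxx.
have /setD1P[yv yt] : y \in t :\ v by rewrite tE !inE eqxx orbT.
by exists x, y; rewrite -tE setD1K //; split=> //; apply: cl'; rewrite // eq_sym.
Qed.

Lemma links1 x : [set w : G | [forall v in [set x], adj v w]] = N x.
Proof.
apply/setP=> w; rewrite !inE; apply/forall_inP/idP => [|xw v].
  by apply; rewrite inE.
by rewrite inE => /eqP->.
Qed.

Lemma links2 x y : [set w : G | [forall v in [set x; y], adj v w]] = L x y.
Proof.
apply/setP=> w; rewrite !inE; apply/forall_inP/andP => [H|[xw yw] v].
  by split; apply: H; rewrite !inE eqxx ?orbT.
by rewrite !inE => /orP[] /eqP->.
Qed.

Lemma links3 x y z :
  [set w : G | [forall v in [set x; y; z], adj v w]] = L x y :&: N z.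
Proof.
apply/setP=> w; rewrite !inE; apply/forall_inP/andP => [H|[/andP[xw yw] zw] v].
  by split; first (apply/andP; split); apply: H; rewrite !inE eqxx ?orbT.
by rewrite !inE => /orP[/orP[]|] /eqP->.
Qed.

Lemma card_induced (S : {set G}) : #|induced S| = #|S|.
Proof. by rewrite /= card_sig. Qed.

Lemma induced_connected (S : {set G}) : connected_graph (induced S) ->
  forall T : {set G}, T \subset S -> T != set0 -> adj_closed T S -> T = S.
Proof.
move=> conS T TS /set0Pn[x xT] clT; apply/eqP; rewrite eqEsubset TS /=.
apply/subsetP=> y yS; have xS := subsetP TS x xT.
have /connectP[p] := conS (Sub x xS) (Sub y yS).
elim: p x xT xS => [|z p IH] x xT xS /=; first by move=> _ [] ->.
case/andP=> xz pz /= yl.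
have zT : val z \in T by apply: clT xT (valP z) _.
apply: (IH (val z) zT (valP z)); first by rewrite (_ : Sub _ _ = z) ?pz //; apply: val_inj.
by rewrite (_ : Sub (val z) _ = z) //; apply: val_inj.
Qed.

Lemma fascinating_spherical_links (R : realType) :
  fascinating R G -> spherical_links G.
Proof.
case=> tri elk tlk vlk.
have elk' x y : adj x y -> exists2 k, (4 <= k) & is_cycle_of_length k (link [set x; y]).
  by move=> xy; apply: elk; apply: edgesP.
split.
- by move: tri; clear; lia.
- move=> x y /elk'[k k4 [_ [f bf _]]].
  by rewrite -links2 -card_induced (bij_eq_card bf) card_ord.
- move=> x y /elk'[k k4 [_ [f [g fK gK] fa]]].
  exists k, (fun i => val (g i)); split.
  + by move=> i j /val_inj/(can_inj gK).
  + rewrite -links2; apply/setP=> z; apply/imsetP/idP => [[i _ ->]|zS].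
      exact: (valP (g i)).
    by exists (f (Sub z zS)) => //; rewrite fK.
  (* Adjacency in [cycle_graph] demands [i != ordS i], which holds since [k] is at least 4; the
     wrap-around at [k - 1] is a separate case. *)
  + move=> i; rewrite -[adj _ _]/(@adj (link _) (g i) (g (ordS i))) -fa !gK /=.
    rewrite /cycle_adj eqxx andbT; apply/eqP=> /(congr1 val) /=.
    have [lt_ik|ge_ik] := ltnP i.+1 k; first by rewrite modn_small //; lia.
    have ik : i.+1 = k by apply/eqP; rewrite eqn_leq ge_ik ltn_ord.
    by rewrite ik modnn; lia.
- move=> x y z xy xz yz.
  by have [<- _] := tlk _ (trianglesP xy xz yz); rewrite -links3 -card_induced.
- move=> x y z u v xy xz yz.
  have [_] := tlk _ (trianglesP xy xz yz).
  by rewrite -links3 => H uS vS; apply: (H (Sub u uS) (Sub v vS)).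
- move=> x S; have [con _ _] := vlk x; rewrite -links1; exact: induced_connected.
- by move=> x; have [_ _] := vlk x; rewrite card_induced links1.
Qed.

End Translation.

(** * Counting edges and triangles by degrees *)

Lemma double_count (I J : finType) (A : {set I}) (B : {set J}) (r : I -> J -> bool) :
  \sum_(i in A) #|[set j in B | r i j]| = \sum_(j in B) #|[set i in A | r i j]|.
Proof.
under eq_bigr do rewrite -sum1dep_card big_mkcondr.
by rewrite exchange_big; under [RHS]eq_bigr do rewrite -sum1dep_card big_mkcondr.
Qed.

(** Ordered adjacent pairs: [degsum (N v) (N v)] is twice the number of edges of the link of [v]. *)
Definition degsum (G : sgraph) (S T : {set G}) := \sum_(x in S) #|T :&: N x|.

Section Counting.
Variable G : sgraph.
Implicit Types x y z v : G.

Lemma degsumC (S T : {set G}) : degsum S T = degsum T S.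
Proof.
transitivity (\sum_(x in S) #|[set y in T | adj x y]|).
  by apply: eq_bigr => x _; apply: eq_card => y; rewrite !inE.
rewrite double_count; apply: eq_bigr => y _; apply: eq_card => x.
by rewrite !inE adj_sym.
Qed.

Lemma card_edges_at (S : {set G}) x : x \in S ->
  #|[set f in edges G | (f \subset S) && (x \in f)]| = #|S :&: N x|.
Proof.
move=> xS; rewrite -(@card_in_imset _ _ (fun y => [set x; y]) (S :&: N x)); last first.
  move=> y z; rewrite !inE => /andP[_ xy] /andP[_ xz] /setP/(_ y).
  by rewrite !inE eqxx orbT eq_sym (negPf (adj_neq xy)) => /esym/eqP.
apply: eq_card => f; rewrite [LHS]in_set; apply/and3P/imsetP => [[fE /subsetP sub xf]|].
  have [u [v [uv fuv]]] := edges_exP fE.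
  move: xf; rewrite fuv !inE => /orP[] /eqP xE; rewrite {}xE.
    by exists v => //; rewrite !inE uv sub // fuv !inE eqxx orbT.
  by exists u; rewrite 1?setUC // !inE adj_sym uv sub // fuv !inE eqxx.
case=> y /setIP[yS]; rewrite in_nbh => xy ->; split; last by rewrite !inE eqxx.
  exact: edgesP.
by apply/subsetP=> z; rewrite !inE => /orP[] /eqP->.
Qed.

Lemma card_edges_in (S : {set G}) :
  2 * #|[set f in edges G | f \subset S]| = degsum S S.
Proof.
set E := [set f in _ | _].
transitivity (\sum_(f in E) #|[set x in S | x \in f]|).
  rewrite mulnC -sum_nat_const; apply: eq_bigr => f; rewrite inE => /andP[].
  case/edges_exP=> x [y [xy ->]] sub; transitivity #|[set x; y]|.
    by rewrite cards2 adj_neq.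
  apply: eq_card => z; rewrite [RHS]inE andb_idl //; exact: (subsetP sub).
rewrite -(double_count S E (fun x f => x \in f)); apply: eq_bigr => x xS.
rewrite -(card_edges_at xS); apply: eq_card => f.
by rewrite [LHS]in_set [RHS]in_set [_ \in E]in_set andbA.
Qed.

Lemma triangle_degree (t : {set G}) x : t \in triangles G -> x \in t -> #|t :&: N x| = 2.
Proof.
move=> tT xt; have [y [z [xy xz yz ->]]] := triangles_exP tT xt.
transitivity #|[set y; z]|; last by rewrite cards2 adj_neq.
apply: eq_card => w; rewrite !inE; have [->|_] := eqVneq w x; last first.
  by rewrite /= andb_idr // => /orP[] /eqP->.
by rewrite adj_irr andbF (negPf (adj_neq xy)) (negPf (adj_neq xz)).
Qed.

Lemma handshake : 2 * #|edges G| = \sum_(x : G) #|N x|.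
Proof.
rewrite (_ : edges G = [set f in edges G | f \subset setT]) ?card_edges_in.
  by apply: eq_big => x *; rewrite ?inE ?setTI.
by apply/setP=> f; rewrite [RHS]in_set subsetT andbT.
Qed.

Lemma card_triangles_at v :
  #|[set t in triangles G | v \in t]| = #|[set f in edges G | f \subset N v]|.
Proof.
rewrite -[RHS](@card_in_imset _ _ (fun f => v |: f)).
  apply: eq_card => t; rewrite [LHS]in_set; apply/andP/imsetP => [[tT vt]|].
    have [x [y [vx vy xy tE]]] := triangles_exP tT vt.
    exists [set x; y] => //; rewrite inE edgesP //=.
    by apply/subsetP=> z; rewrite !inE => /orP[] /eqP->.
  case=> f; rewrite inE => /andP[/edges_exP[x [y [xy ->]]] /subsetP sub] ->.
  have vx : adj v x by rewrite -in_nbh sub // !inE eqxx.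
  have vy : adj v y by rewrite -in_nbh sub // !inE eqxx orbT.
  by split; rewrite ?setUA ?trianglesP // !inE eqxx.
have vf (f : {set G}) : f \subset N v -> v \notin f.
  by move=> /subsetP sub; apply/negP=> /sub; rewrite inE adj_irr.
move=> f g; rewrite [f \in _]in_set [g \in _]in_set => /andP[_ /vf vf1] /andP[_ /vf vg] fg.
by rewrite -(setU1K vf1) fg setU1K.
Qed.

(** Each triangle is seen from its three vertices as an edge of their links, and [degsum] counts an
    edge twice. *)
Lemma six_card_triangles : 6 * #|triangles G| = \sum_(v : G) degsum (N v) (N v).
Proof.
rewrite -[6]/(2 * 3) -mulnA; under [RHS]eq_bigr do rewrite -card_edges_in -card_triangles_at.
rewrite -big_distrr /=; congr (2 * _).
transitivity (\sum_(v in setT) #|[set t in triangles G | v \in t]|); last first.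
  by apply: eq_bigl => v; rewrite inE.
rewrite double_count mulnC -sum_nat_const.
apply: eq_bigr => t; rewrite [_ \in _]in_set => /andP[/eqP t3 _]; rewrite -t3.
by apply: eq_card => x; rewrite !inE.
Qed.

Lemma triangles_on_edge (S : {set G}) x y : adj x y -> x \in S -> y \in S ->
  [set t in triangles G | (t \subset S) && ([set x; y] \subset t)]
  = [set z |: [set x; y] | z in S :&: L x y].
Proof.
move=> xy xS yS.
apply/setP => t; rewrite [LHS]in_set; apply/and3P/imsetP => [[tT /subsetP tS /subsetP xyt]|].
  have xt : x \in t by apply: xyt; rewrite !inE eqxx.
  have yt : y \in t by apply: xyt; rewrite !inE eqxx orbT.
  have [u [v [xu xv uv tE]]] := triangles_exP tT xt.
  have : y \in x |: [set u; v] by rewrite -tE.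
  have [ut vt] : u \in t /\ v \in t by rewrite tE !inE !eqxx !orbT.
  rewrite !inE eq_sym (negPf (adj_neq xy)) /= => /orP[] /eqP yE.
    exists v; first by rewrite !inE tS //= xv yE.
    by rewrite tE yE; apply/setP=> z; rewrite !inE; do !case: eqP.
  exists u; first by rewrite !inE tS //= xu yE adj_sym.
  by rewrite tE yE; apply/setP=> z; rewrite !inE; do !case: eqP.
case=> z /setIP[zS]; rewrite in_L => /andP[xz yz] ->; split.
- by rewrite setUC trianglesP.
- by apply/subsetP=> w; rewrite !inE => /or3P[] /eqP->.
- exact: subsetUr.
Qed.

Lemma apex_inj (S : {set G}) x y :
  {in S :&: L x y &, injective (fun z => z |: [set x; y])}.
Proof.
have zxy z : z \in S :&: L x y -> z \notin [set x; y].
  by rewrite !inE => /and3P[_ xz yz]; rewrite !(eq_sym z) negb_or (adj_neq xz) (adj_neq yz).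
move=> z w /zxy nz /zxy nw /setP/(_ z); rewrite !inE eqxx /= => /esym.
by case/orP => [/eqP //|]; move: nz; rewrite !inE => /negPf->.
Qed.

End Counting.

(** * Euler's formula for vertex links *)

(** The left kernel lies in the span of the all-ones row, so its rank is at most 1. *)
Lemma row_full_but_one (F : fieldType) m n (A : 'M[F]_(m, n)) :
  (forall u : 'rV_m, (u *m A = 0)%R -> forall i j, u ord0 i = u ord0 j) ->
  m <= \rank A + 1.
Proof.
move=> cst; have : \rank (kermx A) <= 1.
  apply: (@leq_trans (\rank (const_mx 1%R : 'rV[F]_m))); last exact: rank_leq_row.
  apply: mxrankS; apply/row_subP=> i; apply/sub_rVP.
  have /cst ui : (row i (kermx A) *m A = 0)%R by rewrite -row_mul mulmx_ker row0.
  exists (row i (kermx A) ord0 i); apply/rowP=> j; rewrite [LHS](ui j i) !mxE.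
  by rewrite GRing.mulr1.
by rewrite mxrank_ker; lia.
Qed.

Lemma val_iter_ordS k (i : 'I_k) t : iter t (@ordS k) i = (i + t) %% k :> nat.
Proof.
elim: t => [|t IH]; first by rewrite addn0 modn_small.
by rewrite -[iter _ _ _]/(ordS (iter t (@ordS k) i)) /= IH -addn1 modnDml addn1 addnS.
Qed.

Section VertexLink.
Variables (G : sgraph) (sphG : spherical_links G) (v : G).
Implicit Types x y z : G.

Lemma edge_link_connected x y (S : {set G}) : adj x y ->
  S \subset L x y -> S != set0 -> adj_closed S (L x y) -> S = L x y.
Proof.
move=> xy SL /set0Pn[s sS] clS; apply/eqP; rewrite eqEsubset SL.
have [k [f [f_inj fL fS]]] := edge_link_cycle sphG xy.
have fLi i : f i \in L x y by rewrite -fL imset_f.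
apply/subsetP=> z; rewrite -fL => /imsetP[j _ ->].
have : s \in L x y by apply: (subsetP SL).
rewrite -fL => /imsetP[i _ si]; rewrite {}si in sS.
have iterS t : f (iter t (@ordS k) i) \in S.
  by elim: t => //= t IH; apply: clS (fLi _) (fS _).
(* From [i], the first [k - i] steps lead to index 0 and the other [j] to [j]. *)
suff <- : iter (k - i + j) (@ordS k) i = j by [].
apply: val_inj; rewrite /= val_iter_ordS addnA subnKC ?modnDl ?modn_small //; exact: ltnW.
Qed.

(** Edges and faces of the link of [v] as a triangulated surface: each edge lies on exactly two
    faces, because the link of a triangle through [v] has two vertices. *)
Let E := [set f in edges G | f \subset N v].
Let F := [set t in triangles G | t \subset N v].

Let U (u : 'rV['F_2]_#|F|) (t : {set G}) : 'F_2 :=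
  (\sum_i u ord0 i *+ (enum_val i == t))%R.

Let UE u i : U u (enum_val i) = u ord0 i.
Proof.
rewrite /U (bigD1 i) //= eqxx big1 ?GRing.addr0 // => j ji.
by rewrite (inj_eq enum_val_inj) (negPf ji).
Qed.

Definition face_edge_mx : 'M['F_2]_(#|F|, #|E|) :=
  \matrix_(i, j) ((enum_val j : {set G}) \subset (enum_val i : {set G}))%:R%R.
Definition edge_vertex_mx : 'M['F_2]_(#|E|, #|N v|) :=
  \matrix_(i, j) ((enum_val j : G) \in (enum_val i : {set G}))%:R%R.

(** A triangle has exactly two edges at each of its vertices, and 2 = 0 in F_2. Hence the ranks of
    the two matrices add up to at most [#|E|]. *)
Lemma boundary_of_boundary : (face_edge_mx *m edge_vertex_mx = 0)%R.
Proof.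
apply/matrixP=> i k; rewrite !mxE; set t : {set G} := enum_val i; set x : G := enum_val k.
transitivity ((\sum_(e in E) ((e \subset t) && (x \in e)))%:R : 'F_2)%R.
  rewrite GRing.natr_sum [RHS]big_enum_val; apply: eq_bigr => j _.
  by rewrite !mxE -GRing.natrM mulnb.
rewrite -big_mkcondr sum1dep_card /=.
have /setIdP[tT tN] : t \in F by exact: enum_valP.
have [xt|xt] := boolP (x \in t); last first.
  rewrite eq_card0 // => e; rewrite inE; apply/negP=> /and3P[_ /subsetP et /et].
  exact/negP.
rewrite (_ : #|_| = 2); first by apply/val_inj.
rewrite -(triangle_degree tT xt) -(card_edges_at xt); apply: eq_card => e.
rewrite [LHS]in_set [RHS]in_set [_ \in E]in_set -andbA; congr (_ && _).
by have [et|] := boolP (e \subset t); rewrite ?andbF // (subset_trans et tN).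
Qed.

Lemma common_nbh_pair x y : x \in N v -> y \in L v x ->
  exists p q, [/\ p != q, p \in N v :&: L x y & N v :&: L x y = [set p; q]].
Proof.
rewrite in_nbh => vx; rewrite in_L => /andP[vy xy].
have := triangle_link sphG vx vy xy; rewrite -setIA => /eqP/cards2P[p [q [pq E2]]].
by exists p, q; split; rewrite // E2 !inE eqxx.
Qed.

Section Cycle.
Variable u : 'rV['F_2]_#|F|.
Hypothesis u_cycle : (u *m face_edge_mx = 0)%R.

(** The entry of [u *m face_edge_mx] at the edge [x y] is the sum of the values of the two faces on
    it; it vanishes, so in characteristic 2 the values agree. *)
Lemma cycle_flip x y p q : x \in N v -> y \in L v x ->
  p \in N v :&: L x y -> q \in N v :&: L x y ->
  U u (p |: [set x; y]) = U u (q |: [set x; y]).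
Proof.
move=> xN yL pL qL; have /andP[vy xy] : adj v y && adj x y by rewrite -in_L.
have yN : y \in N v by rewrite in_nbh.
have eE : [set x; y] \in E.
  by rewrite in_set edgesP //; apply/subsetP=> w; rewrite in_set2 => /orP[] /eqP->.
have : (\sum_(t in [set z |: [set x; y] | z in N v :&: L x y]) U u t = 0)%R.
  have /rowP/(_ (enum_rank_in eE [set x; y])) := u_cycle.
  rewrite !mxE => sum0; rewrite -triangles_on_edge // -[RHS]sum0.
  transitivity (\sum_(t in F) U u t *+ ([set x; y] \subset t))%R.
    under [RHS]eq_bigr do rewrite GRing.mulrb.
    rewrite -big_mkcondr. apply: eq_bigl => t.
    by rewrite in_set [t \in F]in_set andbA.
  rewrite big_enum_val; apply: eq_bigr => i _.
  by rewrite !mxE UE GRing.mulr_natr enum_rankK_in.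
rewrite big_imset; last exact: apex_inj.
have [a [b [ab _ E2]]] := common_nbh_pair xN yL.
rewrite /= E2 big_setU1 ?inE //= big_set1 => /eqP.
rewrite GRing.addr_eq0 GRing.oppr_pchar2 ?pchar_Fp // => /eqP Uab.
by move: pL qL; rewrite E2 !inE => /orP[] /eqP-> /orP[] /eqP->.
Qed.

(** Rotation about [x]: the link of the edge [v x] is a cycle, and for consecutive [a], [b] on it
    the face [x a b] lies on both edges [x a] and [x b], which passes the value on. *)
Lemma cycle_const_at_vertex x y z y' z' : x \in N v ->
  y \in L v x -> z \in N v :&: L x y -> y' \in L v x -> z' \in N v :&: L x y' ->
  U u (z |: [set x; y]) = U u (z' |: [set x; y']).
Proof.
move=> xN yL zL y'L z'L; set c := U u _.
pose T := [set w in L v x | [forall p in N v :&: L x w, U u (p |: [set x; w]) == c]].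
suff TE : T = L v x.
  move: y'L; rewrite -TE inE => /andP[_ /forall_inP/(_ z' z'L) /eqP->//].
apply: edge_link_connected; first by rewrite -in_nbh.
- by apply/subsetP=> w /setIdP[].
- apply/set0Pn; exists y; rewrite inE yL; apply/forall_inP=> p pL.
  by apply/eqP; apply: cycle_flip.
move=> a b /setIdP[aL /forall_inP aT] bL ab.
move: (aL) (bL); rewrite !in_L => /andP[va xa] /andP[vb xb].
have baL : b \in N v :&: L x a by rewrite in_setI in_nbh vb in_L xb.
have abL : a \in N v :&: L x b by rewrite in_setI in_nbh va in_L xa adj_sym.
rewrite inE bL; apply/forall_inP=> p pL; rewrite (cycle_flip xN bL pL abL).
rewrite -(eqP (aT b baL)) (_ : a |: _ = b |: [set x; a]) //.
by apply/setP=> w; rewrite !inE; do !case: eqP.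
Qed.

Lemma face_at x t : t \in F -> x \in t -> exists y z,
  [/\ x \in N v, y \in L v x, z \in N v :&: L x y & t = z |: [set x; y]].
Proof.
rewrite in_set => /andP[tT /subsetP tN] xt; have [y [z [xy xz yz tE]]] := triangles_exP tT xt.
have [vx vy vz] : [/\ adj v x, adj v y & adj v z].
  by split; rewrite -in_nbh; apply: tN; rewrite // tE !inE eqxx ?orbT.
exists y, z; split; rewrite ?inE ?vx ?vy ?vz ?xy ?xz //.
by rewrite tE; apply/setP=> w; rewrite !inE; do !case: eqP.
Qed.

(** Adjacent vertices of [N v] share a face, so the vertices all of whose faces carry the value [c]
    form a closed subset of the connected link of [v]. *)
Lemma cycle_const t t' : t \in F -> t' \in F -> U u t = U u t'.
Proof.
move=> tF t'F.
have ex_in (s : {set G}) : s \in F -> exists x, x \in s.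
  rewrite in_set => /andP[sT _]; apply/set0Pn; rewrite -card_gt0.
  by move: sT; rewrite in_set => /andP[/eqP-> _].
have [x0 x0t] := ex_in t tF; set c := U u t.
pose S := [set x in N v | [forall s in F, (x \in s) ==> (U u s == c)]].
have at_const x y z s : x \in N v -> y \in L v x -> z \in N v :&: L x y ->
    U u (z |: [set x; y]) = c -> s \in F -> x \in s -> U u s = c.
  move=> xN yL zL <- sF xs; have [y' [z' [_ y'L z'L ->]]] := face_at sF xs.
  exact: cycle_const_at_vertex.
have in_S x y z : x \in N v -> y \in L v x -> z \in N v :&: L x y ->
    U u (z |: [set x; y]) = c -> x \in S.
  move=> xN yL zL Uc; rewrite inE xN; apply/forall_inP=> s sF.
  by apply/implyP=> xs; apply/eqP; exact: at_const Uc sF xs.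
have SN : S = N v.
  apply: (vertex_link_connected sphG); first by apply/subsetP=> x /setIdP[].
    have [y [z [xN yL zL tE]]] := face_at tF x0t.
    by apply/set0Pn; exists x0; apply: in_S zL _; rewrite -?tE.
  move=> x y /setIdP[xN /forall_inP xS]; rewrite !in_nbh => vy xy.
  have yL : y \in L v x by rewrite in_L vy.
  have [p [_ [_ pL _]]] := common_nbh_pair xN yL.
  have pL' : p \in N v :&: L y x by rewrite [L y x]setIC.
  apply: (in_S y x p) => //; first by rewrite in_nbh.
    by rewrite in_L -in_nbh xN adj_sym.
  apply/eqP; apply: (implyP (xS _ _)); last by rewrite !inE eqxx !orbT.
  move: pL'; rewrite in_setI in_L !in_nbh => /and3P[vp yp xp].
  have yx : adj y x by rewrite adj_sym.
  rewrite in_set setUC (trianglesP yx yp xp) /=; apply/subsetP=> w.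
  by rewrite !inE -orbA => /or3P[] /eqP->; rewrite ?vy ?vp -?in_nbh ?xN.
have [x1 x1t] := ex_in t' t'F.
have [y [z [xN _ _ _]]] := face_at t'F x1t.
move: xN; rewrite -SN inE => /andP[_ /forall_inP/(_ t' t'F)].
by rewrite x1t => /eqP.
Qed.

End Cycle.
(** Incidences counted twice: three edges per face, two faces per edge. *)
Lemma card_faces : 3 * #|F| = 2 * #|E|.
Proof.
transitivity (\sum_(t in F) #|[set e in E | e \subset t]|).
  rewrite mulnC -sum_nat_const; apply: eq_bigr => t tF.
  have /setIdP[tT tN] := tF; apply/eqP; rewrite -(eqn_pmul2l (isT : 0 < 2)).
  rewrite (_ : [set e in E | _] = [set e in edges G | e \subset t]).
    rewrite card_edges_in /degsum (eq_bigr (fun=> 2)); last by move=> x; exact: triangle_degree.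
    by rewrite sum_nat_const; move: tT; rewrite in_set => /andP[/eqP->].
  apply/setP=> e; rewrite [LHS]in_set [RHS]in_set [e \in E]in_set -andbA.
  by have [et|] := boolP (e \subset t); rewrite ?andbF // (subset_trans et tN).
rewrite -(double_count E F (fun e t => e \subset t)) mulnC -sum_nat_const.
apply: eq_bigr => e; rewrite in_set => /andP[/edges_exP[x [y [xy ->]]] /subsetP sub].
have xN : x \in N v by apply: sub; rewrite !inE eqxx.
have yN : y \in N v by apply: sub; rewrite !inE eqxx orbT.
rewrite -(triangle_link sphG _ _ xy (x := v)) -?in_nbh // -setIA.
rewrite -(card_in_imset (@apex_inj _ (N v) x y)) -triangles_on_edge //.
by apply: eq_card => t; rewrite [LHS]in_set [RHS]in_set [t \in F]in_set andbA.
Qed.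

(** Over F_2 the equation at an edge says that its ends carry equal values, and the link of [v] is
    connected. *)
Lemma vertex_edge_kernel (w : 'rV['F_2]_#|N v|) :
  (w *m edge_vertex_mx^T = 0)%R -> forall i j, w ord0 i = w ord0 j.
Proof.
move=> w0; pose W (x : G) : 'F_2 := (\sum_i w ord0 i *+ (enum_val i == x))%R.
have WE i : W (enum_val i) = w ord0 i.
  rewrite /W (bigD1 i) //= eqxx big1 ?GRing.addr0 // => j ji.
  by rewrite (inj_eq enum_val_inj) (negPf ji).
have Wadj x y : x \in N v -> y \in N v -> adj x y -> W x = W y.
  move=> xN yN xy; have eE : [set x; y] \in E.
    by rewrite in_set edgesP //; apply/subsetP=> z; rewrite in_set2 => /orP[] /eqP->.
  have : (\sum_(z in [set x; y]) W z = 0)%R.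
    have /rowP/(_ (enum_rank_in eE [set x; y])) := w0.
    rewrite !mxE => sum0; rewrite -[RHS]sum0.
    transitivity (\sum_(z in N v) W z *+ (z \in [set x; y]))%R.
      under [RHS]eq_bigr do rewrite GRing.mulrb.
      rewrite -big_mkcondr; apply: eq_bigl => z; rewrite andbC andb_idr //.
      by rewrite in_set2 => /orP[] /eqP->.
    rewrite big_enum_val; apply: eq_bigr => i _.
    by rewrite !mxE WE GRing.mulr_natr enum_rankK_in.
  rewrite big_setU1 ?inE ?adj_neq //= big_set1 => /eqP.
  by rewrite GRing.addr_eq0 GRing.oppr_pchar2 ?pchar_Fp // => /eqP.
move=> i j; rewrite -!WE; set x := enum_val i.
have xN : x \in N v by exact: enum_valP.
pose S := [set y in N v | W y == W x].
suff SN : S = N v.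
  by have : enum_val j \in S by [rewrite SN; exact: enum_valP]; rewrite inE => /andP[_ /eqP].
apply: (vertex_link_connected sphG); first by apply/subsetP=> y /setIdP[].
  by apply/set0Pn; exists x; rewrite inE xN eqxx.
move=> y z /setIdP[yN /eqP yx] zN yz.
by rewrite inE zN -yx (Wadj y z) ?eqxx.
Qed.

(* V - E + F <= 2 for the link of [v], where 3 F = 2 E *)
Lemma link_euler : 6 * #|N v| <= degsum (N v) (N v) + 12.
Proof.
have rF : #|F| <= \rank face_edge_mx + 1.
  apply: row_full_but_one => u u0 i j; rewrite -!UE.
  by apply: cycle_const => //; exact: enum_valP.
have rV : #|N v| <= \rank edge_vertex_mx + 1.
  by rewrite -mxrank_tr; apply: row_full_but_one vertex_edge_kernel.
have := mulmx0_rank_max boundary_of_boundary.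
rewrite -card_edges_in -/E; have := card_faces; move: rF rV.
by move: (\rank _) (\rank _); lia.
Qed.

End VertexLink.

(** Summed over all vertices, both sides of [link_euler] equal 12 times the number of edges, by the
    triangle count and the handshake; so no single inequality is strict. *)
Lemma link_euler_eq (G : sgraph) (v : G) : spherical_links G ->
  degsum (N v) (N v) + 12 = 6 * #|N v|.
Proof.
move=> sphG.
have sumE : \sum_(x : G) (degsum (N x) (N x) + 12) = \sum_(x : G) 6 * #|N x|.
  transitivity (6 * \sum_(x : G) #|N x|); last by rewrite big_distrr.
  transitivity (\sum_(x : G) degsum (N x) (N x) + \sum_(x : G) 12); first by rewrite big_split.
  rewrite sum_nat_const -six_card_triangles -handshake.
  by have := triangle_count sphG; rewrite -/(#|G|); lia.
have := @leqif_sum _ predT _ _ _ (fun x _ => leqif_eq (link_euler sphG x)).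
by case=> _; rewrite sumE eqxx => /esym/forall_inP/(_ v isT)/eqP.
Qed.

(** * A K4 with two long edge links *)

Definition K4 (G : sgraph) (a b c d : G) : bool :=
  [&& adj a b, adj a c, adj a d, adj b c, adj b d & adj c d].

Lemma sqr_sum_le (I : finType) (f : I -> nat) :
  (\sum_i f i) ^ 2 <= #|I| * \sum_i f i ^ 2.
Proof.
have le2 : \sum_i \sum_j 2 * (f i * f j) <= \sum_i \sum_j (f i ^ 2 + f j ^ 2).
  by apply: leq_sum => i _; apply: leq_sum => j _; exact: nat_Cauchy.
rewrite -(leq_pmul2l (isT : 0 < 2)) -mulnn big_distrl big_distrr /=.
under eq_bigr do rewrite big_distrr big_distrr /=.
apply: (leq_trans le2); under eq_bigr do rewrite big_split sum_nat_const /=.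
by rewrite big_split sum_nat_const -big_distrr mul2n -addnn.
Qed.

Section Averaging.
Variables (G : sgraph) (sphG : spherical_links G).
Implicit Types a b c d x : G.

(** An ordered K4 starting at [a] is a neighbour [b], then [c] in [L a b], then one of the two
    vertices in the link of the triangle [a b c]. *)
Lemma sum_K4_first (f : G -> nat) :
  \sum_(a : G) \sum_(b : G) \sum_(c : G) \sum_(d : G) K4 a b c d * f a
  = \sum_(a : G) (2 * degsum (N a) (N a)) * f a.
Proof.
apply: eq_bigr => a _; rewrite /degsum big_distrr big_distrl /= [RHS]big_mkcond /=.
apply: eq_bigr => b _; rewrite in_nbh; have [ab|nab] := boolP (adj a b); last first.
  by rewrite big1 // => c _; rewrite big1 // => d _; rewrite /K4 (negPf nab).
transitivity (\sum_(c in L a b) 2 * f a); last by rewrite sum_nat_const; lia.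
rewrite [RHS]big_mkcond; apply: eq_bigr => c _; rewrite in_L -big_distrl.
have [/andP[ac bc]|nabc] := boolP (adj a c && adj b c); last first.
  rewrite big1 // => d _; rewrite /K4; move: nabc.
  by case: (adj a c); case: (adj b c); rewrite ?andbF.
congr (_ * _); rewrite -(triangle_link sphG ab ac bc) -sum1_card [RHS]big_mkcond /=.
apply: eq_bigr => d _; rewrite in_setI in_L in_nbh /K4 ab ac bc /=.
by rewrite andbA; case: (_ && _).
Qed.

Lemma sum_K4_second (f : G -> nat) :
  \sum_(a : G) \sum_(b : G) \sum_(c : G) \sum_(d : G) K4 a b c d * f b
  = \sum_(a : G) \sum_(b : G) \sum_(c : G) \sum_(d : G) K4 a b c d * f a.
Proof.
rewrite exchange_big; apply: eq_bigr => a _; apply: eq_bigr => b _.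
apply: eq_bigr => c _; apply: eq_bigr => d _; congr (_ * _).
by rewrite /K4 (adj_sym a b); do 6 case: (adj _ _).
Qed.

Lemma sum_K4_third (f : G -> nat) :
  \sum_(a : G) \sum_(b : G) \sum_(c : G) \sum_(d : G) K4 a b c d * f c
  = \sum_(a : G) \sum_(b : G) \sum_(c : G) \sum_(d : G) K4 a b c d * f a.
Proof.
rewrite -[RHS]sum_K4_second; apply: eq_bigr => a _; rewrite exchange_big.
apply: eq_bigr => b _; apply: eq_bigr => c _; apply: eq_bigr => d _; congr (_ * _).
by rewrite /K4 (adj_sym b c); do 6 case: (adj _ _).
Qed.

Lemma sum_K4_fourth (f : G -> nat) :
  \sum_(a : G) \sum_(b : G) \sum_(c : G) \sum_(d : G) K4 a b c d * f d
  = \sum_(a : G) \sum_(b : G) \sum_(c : G) \sum_(d : G) K4 a b c d * f a.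
Proof.
rewrite -[RHS]sum_K4_third; apply: eq_bigr => a _; apply: eq_bigr => b _.
rewrite exchange_big; apply: eq_bigr => c _; apply: eq_bigr => d _; congr (_ * _).
by rewrite /K4 (adj_sym c d); do 6 case: (adj _ _).
Qed.

(** Averaging over ordered K4's, of which s = 12 d - 24 start at a vertex of degree d. If all degree
    sums were at most 2n + 4, then 4 sum s d <= (2n + 4) sum s, and Cauchy-Schwarz turns this into
    4m (m - n) <= n (n + 2) (m - n). *)
Lemma ex_K4_large_degree_sum :
  #|G| ^ 2 + 2 * #|G| < 4 * #|edges G| ->
  exists a b c d, K4 a b c d /\ 2 * #|G| + 5 <= #|N a| + #|N b| + #|N c| + #|N d|.
Proof.
move=> large; pose D (a b c d : G) := #|N a| + #|N b| + #|N c| + #|N d|.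
have [] := boolP [exists a : G, [exists b, [exists c, [exists d,
    K4 a b c d && (2 * #|G| + 5 <= D a b c d)]]]].
  by case/existsP=> a /existsP[b /existsP[c /existsP[d /andP[]]]]; exists a, b, c, d.
move=> none; exfalso.
have leD a b c d : K4 a b c d * D a b c d <= K4 a b c d * (2 * #|G| + 4).
  have [Ka|//] := boolP (K4 a b c d); rewrite !mul1n leqNgt; apply: contra none => lt.
  apply/existsP; exists a; apply/existsP; exists b; apply/existsP; exists c.
  by apply/existsP; exists d; rewrite Ka addnS.
pose s a := 2 * degsum (N a) (N a).
have : \sum_(a : G) \sum_(b : G) \sum_(c : G) \sum_(d : G) K4 a b c d * D a b c d
    <= \sum_(a : G) \sum_(b : G) \sum_(c : G) \sum_(d : G) K4 a b c d * (2 * #|G| + 4).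
  by do 4 (apply: leq_sum => ? _).
have -> : \sum_(a : G) \sum_(b : G) \sum_(c : G) \sum_(d : G) K4 a b c d * (2 * #|G| + 4)
    = (2 * #|G| + 4) * \sum_(a : G) s a.
  by rewrite (sum_K4_first (fun=> 2 * #|G| + 4)) [RHS]mulnC big_distrl.
have -> : \sum_(a : G) \sum_(b : G) \sum_(c : G) \sum_(d : G) K4 a b c d * D a b c d = 4 * \sum_(a : G) s a * #|N a|.
  have split4 : \sum_(a : G) \sum_(b : G) \sum_(c : G) \sum_(d : G) K4 a b c d * D a b c d
    = \sum_(a : G) \sum_(b : G) \sum_(c : G) \sum_(d : G) K4 a b c d * #|N a|
    + \sum_(a : G) \sum_(b : G) \sum_(c : G) \sum_(d : G) K4 a b c d * #|N b|
    + \sum_(a : G) \sum_(b : G) \sum_(c : G) \sum_(d : G) K4 a b c d * #|N c|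
    + \sum_(a : G) \sum_(b : G) \sum_(c : G) \sum_(d : G) K4 a b c d * #|N d|.
    do 4 (rewrite -!big_split; apply: eq_bigr => ? _).
    by rewrite /D !mulnDr.
  rewrite {}split4 sum_K4_second sum_K4_third sum_K4_fourth (sum_K4_first (fun a => #|N a|)).
  by rewrite -[4]/(1 + 1 + 1 + 1) !mulnDl !mul1n.
have sE a : s a + 24 = 12 * #|N a| by have := link_euler_eq a sphG; rewrite /s; lia.
have sumd : \sum_(a : G) #|N a| = 2 * #|edges G| by rewrite handshake.
have sums : \sum_(a : G) s a + 24 * #|G| = 24 * #|edges G|.
  rewrite -[24 in RHS]/(12 * 2) -mulnA -sumd [24 * _]mulnC -sum_nat_const -big_split.
  by rewrite big_distrr; apply: eq_bigr => a _; rewrite /= sE.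
have sumsd : \sum_(a : G) s a * #|N a| + 48 * #|edges G| = 12 * \sum_(a : G) #|N a| ^ 2.
  rewrite -[48]/(24 * 2) -mulnA -sumd !big_distrr -big_split.
  by apply: eq_bigr => a _; rewrite /= -mulnDl sE -mulnA mulnn.
(* This makes m - n positive, so that it cancels. *)
have deg6 : 6 * #|G| <= 2 * #|edges G|.
  rewrite -sumd mulnC -sum_nat_const; apply: leq_sum => a _; exact: degree_ge6.
have := sqr_sum_le (fun a : G => #|N a|); rewrite sumd.
move: sums sumsd deg6 large; move: (\sum_a _) (\sum_a _) (\sum_a _) #|edges G| #|G|.
by clear; nia.
Qed.
End Averaging.

(** * Traces of vertices and edges on a K4 *)

Lemma card_sum_bool (T : finType) (A : {set T}) : #|A| = \sum_x (x \in A).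
Proof. by rewrite -sum1_card big_mkcond; apply: eq_bigr => x _; case: (x \in A). Qed.

Lemma sum_indicator_mul (T : finType) (A B : {set T}) :
  \sum_x \sum_y (x \in A) * (y \in B) = #|A| * #|B|.
Proof.
rewrite !card_sum_bool big_distrl; apply: eq_bigr => x _.
by rewrite big_distrr.
Qed.

Lemma degsum_indicator (G : sgraph) (S T : {set G}) :
  degsum S T = \sum_(x : G) \sum_(y : G) (x \in S) * ((y \in T) * adj x y).
Proof.
rewrite /degsum big_mkcond; apply: eq_bigr => x _; rewrite -big_distrr /=.
case: (x \in S); rewrite ?mul0n // mul1n card_sum_bool; apply: eq_bigr => y _.
by rewrite in_setI in_nbh mulnb.
Qed.

(** Otherwise [d] and [x] would be adjacent vertices in the link of the triangle [a b c]. *)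
Lemma K4_common_nbh3 (G : sgraph) (sphG : spherical_links G) (a b c d x : G) :
  K4 a b c d -> ~~ [&& adj a x, adj b x, adj c x & adj d x].
Proof.
case/and5P=> ab ac ad bc /andP[bd cd]; apply/negP=> /and4P[ax bx cx].
by apply/negP; apply: (no_K5 sphG ab ac bc); rewrite in_setI in_L in_nbh ?ad ?bd ?ax ?bx.
Qed.

Section Split.
Variables (G : sgraph) (sphG : spherical_links G) (a b c d : G).
Hypothesis Kabcd : K4 a b c d.
Implicit Types x y : G.

Let k x := adj a x + adj b x + adj c x + adj d x.
Let low := [set x | k x <= 1].

(** As no trace has size 4, [full x] is 1 for traces of size 3 and 0 for all others. *)
Let full x := (adj a x && adj b x && adj c x) + (adj a x && adj b x && adj d x)
  + (adj a x && adj c x && adj d x) + (adj b x && adj c x && adj d x).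

Lemma sum_full : \sum_x full x = 8.
Proof.
have /and5P[ab ac ad bc /andP[bd cd]] := Kabcd.
have tri (u v w : G) : adj u v -> adj u w -> adj v w ->
    \sum_x (adj u x && adj v x && adj w x) = 2.
  move=> uv uw vw; rewrite -(triangle_link sphG uv uw vw) card_sum_bool.
  by apply: eq_bigr => x _; rewrite !inE.
by rewrite /full !big_split /= !tri.
Qed.

Lemma sum_four_degrees : \sum_x k x = #|N a| + #|N b| + #|N c| + #|N d|.
Proof.
rewrite /k !big_split !card_sum_bool.
by congr (_ + _ + _ + _); apply: eq_bigr => x _; rewrite in_nbh.
Qed.

(** Pointwise, [k x] plus the indicator of [low] is at most 2 + [full x]. *)
Lemma card_low : #|N a| + #|N b| + #|N c| + #|N d| + #|low| <= 2 * #|G| + 8.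
Proof.
have -> : 2 * #|G| = \sum_(x : G) 2 by rewrite sum_nat_const mulnC.
rewrite -sum_four_degrees -sum_full card_sum_bool -!big_split.
apply: leq_sum => x _; rewrite inE /=; have := K4_common_nbh3 sphG x Kabcd; rewrite /k /full.
by case: (adj a x); case: (adj b x); case: (adj c x); case: (adj d x).
Qed.

(** A trace of size 2 contains one pair and a trace of size 3 contains three, so [x] is in at most 1
    + 2 [full x] of the six links. *)
Lemma sum_edge_links :
  #|L a b| + #|L c d| + #|L a c| + #|L b d| + #|L a d| + #|L b c| <= #|G| + 16.
Proof.
have -> : #|G| = \sum_(x : G) 1 by rewrite sum1_card.
rewrite -[16]/(2 * 8) -sum_full big_distrr !card_sum_bool -!big_split /=.
apply: leq_sum => x _; rewrite !in_L; have := K4_common_nbh3 sphG x Kabcd; rewrite /full.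
by case: (adj a x); case: (adj b x); case: (adj c x); case: (adj d x).
Qed.

(** An edge whose ends have a common neighbour on the K4 is counted by a [degsum]. Otherwise the
    traces of its ends are disjoint, hence complementary pairs unless one has size at most 1. *)
Lemma edges_by_split :
  2 * #|edges G| <= degsum (N a) (N a) + degsum (N b) (N b) + degsum (N c) (N c)
    + degsum (N d) (N d) + 2 * (#|L a b| * #|L c d| + #|L a c| * #|L b d|
    + #|L a d| * #|L b c|) + 2 * #|low| * #|G|.
Proof.
have -> : 2 * #|edges G| = \sum_(x : G) \sum_(y : G) adj x y.
  rewrite handshake; apply: eq_bigr => x _; rewrite card_sum_bool.
  by apply: eq_bigr => y _; rewrite in_nbh.
have -> : 2 * (#|L a b| * #|L c d| + #|L a c| * #|L b d| + #|L a d| * #|L b c|)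
  = (#|L a b| * #|L c d| + #|L c d| * #|L a b|) + (#|L a c| * #|L b d| + #|L b d| * #|L a c|)
    + (#|L a d| * #|L b c| + #|L b c| * #|L a d|) by lia.
have -> : 2 * #|low| * #|G| = #|low| * #|[set: G]| + #|[set: G]| * #|low|.
  by rewrite cardsT; lia.
rewrite !degsum_indicator -!sum_indicator_mul -!big_split.
apply: leq_sum => x _; rewrite -!big_split; apply: leq_sum => y _.
rewrite !in_L !in_nbh !inE /k /=.
have := K4_common_nbh3 sphG x Kabcd; have := K4_common_nbh3 sphG y Kabcd.
case: (adj a x); case: (adj b x); case: (adj c x); case: (adj d x) => //;
by case: (adj a y); case: (adj b y); case: (adj c y); case: (adj d y) => //; case: (adj x y).
Qed.

End Split.

(** At most three vertices are low and the four [degsum] terms add up to at most 12n. If all three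
    pairings missed 50 vertices or more, AM-GM would give 4m <= 36n + (n + 16)(n - 50), where 50
    makes the linear terms sum to exactly 2n. *)
Lemma ex_K4_long_links (G : sgraph) : spherical_links G ->
  #|G| ^ 2 + 2 * #|G| + 17 < 4 * #|edges G| ->
  exists a b c d : G, K4 a b c d /\ #|G| <= #|L a b| + #|L c d| + 49.
Proof.
move=> sphG large.
have [|a [b [c [d [K sumd]]]]] := ex_K4_large_degree_sum sphG.
  by apply: leq_ltn_trans large; rewrite leq_addr.
have le_low := card_low sphG K; have leL := sum_edge_links sphG K.
have leE := edges_by_split sphG K.
have ea := link_euler_eq a sphG; have eb := link_euler_eq b sphG.
have ec := link_euler_eq c sphG; have ed := link_euler_eq d sphG.
have /and5P[ab ac ad bc /andP[bd cd]] := K.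
have [le1|lt1] := leqP #|G| (#|L a b| + #|L c d| + 49); first by exists a, b, c, d.
have [le2|lt2] := leqP #|G| (#|L a c| + #|L b d| + 49).
  by exists a, c, b, d; split=> //; rewrite /K4 ac ab ad bd cd adj_sym bc.
have [le3|lt3] := leqP #|G| (#|L a d| + #|L b c| + 49).
  by exists a, d, b, c; split=> //; rewrite /K4 ad ab ac bc (adj_sym d b) bd (adj_sym d c) cd.
move: large le_low leL leE ea eb ec ed lt1 lt2 lt3 sumd.
set low := [set x | _]; move: #|low| (degsum _ _) (degsum _ _) (degsum _ _) (degsum _ _).
move: #|N a| #|N b| #|N c| #|N d| #|L a b| #|L c d| #|L a c| #|L b d| #|L a d| #|L b c|.
move: #|edges G| #|G| => m n da db dc dd l1 l1' l2 l2' l3 l3' lo sa sb sc sd.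
move=> large le_low leL leE ea eb ec ed lt1 lt2 lt3 sumd.
have amgm x y : x + y + 49 < n -> 4 * (x * y) <= (x + y) * (n - 50).
  move=> lt; apply: leq_trans (nat_AGM2 x y) _; rewrite -mulnn leq_mul2l.
  by apply/orP; right; lia.
have := leq_add (leq_add (amgm _ _ lt1) (amgm _ _ lt2)) (amgm _ _ lt3); rewrite -!mulnDl => le12.
have le3 : lo * n <= 3 * n by rewrite leq_mul2r; apply/orP; right; lia.
have leq4 : 4 * (l1 * l1' + l2 * l2' + l3 * l3') <= (n + 16) * (n - 50).
  rewrite !mulnDr; apply: leq_trans le12 _; rewrite leq_mul2r; apply/orP; right; lia.
have [k nE] : exists k, n = k + 50 by exists (n - 50); lia.
move: large leE leq4 le3; rewrite nE addnK -mulnn -[2 * lo * _]mulnA.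
move: (l1 * l1' + l2 * l2' + l3 * l3') (lo * (k + 50)) => p q.
subst n; lia.
Qed.

(** * Two disjoint edge links missing at most one vertex *)

Lemma K4_swap (G : sgraph) (a b c d : G) : K4 a b c d -> K4 c d a b.
Proof.
case/and5P=> ab ac ad bc /andP[bd cd].
by rewrite /K4 cd (adj_sym c a) ac (adj_sym c b) bc (adj_sym d a) ad (adj_sym d b) bd.
Qed.

Section TwoCycles.
Variables (G : sgraph) (sphG : spherical_links G).
Implicit Types x y w : G.

Lemma edge_link_covered x y (P Q : {set G}) : adj x y ->
  L x y \subset P :|: Q -> #|P| <= 2 -> #|Q| <= 2 -> L x y = P :|: Q.
Proof.
move=> xy sub P2 Q2; apply/eqP; rewrite eqEcard sub.
apply: leq_trans (edge_link_ge4 sphG xy); apply: leq_trans (leq_card_setU P Q) _.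
exact: leq_add P2 Q2.
Qed.

Lemma edge_link_degree (a b : G) x : adj a b -> x \in L a b -> #|L a b :&: N x| = 2.
Proof. by move=> ab; rewrite in_L => /andP[ax bx]; apply: triangle_link. Qed.

Section Split.
Variables a b c d : G.
Hypothesis Kabcd : K4 a b c d.
Let X := L a b.
Let Y := L c d.

Lemma K4_mem : [/\ adj a b, adj c d, a \in Y, b \in Y & c \in X /\ d \in X].
Proof.
have /and5P[ab ac ad bc /andP[bd cd]] := Kabcd.
by rewrite !in_L (adj_sym c a) (adj_sym d a) (adj_sym c b) (adj_sym d b) ab cd ac ad bc bd.
Qed.

Lemma edge_links_disjoint x : x \in X -> x \notin Y.
Proof.
rewrite !in_L => /andP[ax bx]; apply/negP=> /andP[cx dx].
by have := K4_common_nbh3 sphG x Kabcd; rewrite ax bx cx dx.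
Qed.

(** The link of [x y] can use only the two neighbours of [x] on [X] and the two of [y] on [Y];
    having at least four vertices, it uses them all. *)
Lemma edge_link_adj_spread x y : x \in X -> y \in Y -> adj x y ->
  L x y \subset X :|: Y -> X :&: N x \subset N y /\ Y :&: N y \subset N x.
Proof.
have [ab cd _ _ _] := K4_mem.
move=> xX yY xy /subsetP sub; have LE : L x y = (X :&: N x) :|: (Y :&: N y).
  apply: edge_link_covered; rewrite ?edge_link_degree //.
  apply/subsetP=> w wL; have := sub w wL; move: wL; rewrite in_L => /andP[xw yw].
  by rewrite !in_setU !in_setI !in_nbh xw yw !andbT.
split; apply/subsetP=> w wS; have : w \in L x y by rewrite LE in_setU wS ?orbT.
  by rewrite in_setI => /andP[].
by rewrite in_setI => /andP[].
Qed.

(** By spreading, the neighbours of [x] on [Y] are closed along the cycle, and [a] is one of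
    them. *)
Lemma edge_link_join x : x \in X ->
  (forall y, y \in Y -> adj x y -> L x y \subset X :|: Y) -> Y \subset N x.
Proof.
have [_ cd aY _ _] := K4_mem.
move=> xX sub; suff <- : Y :&: N x = Y by exact: subsetIr.
apply: (edge_link_connected sphG cd); first exact: subsetIl.
  apply/set0Pn; exists a; rewrite in_setI aY in_nbh adj_sym.
  by move: xX; rewrite in_L => /andP[].
move=> y w /setIP[yY]; rewrite in_nbh => xy wY yw.
have [_ /subsetP subx] := edge_link_adj_spread xX yY xy (sub y yY xy).
by rewrite in_setI wY subx // in_setI wY in_nbh.
Qed.

(** Where [X] passes from neighbours to non-neighbours of the missed vertex [z], the last neighbour
    [x1] is still joined to all of [Y]. A common neighbour [x2] of [z] and [x1] on [X] then serves:
    its neighbours in [Y :&: N z] lie in the two-vertex link of [z x1 x2]. *)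
Lemma ex_boundary_vertex z : ~: (X :|: Y) = [set z] ->
  exists2 x, x \in X :&: N z & #|Y :&: N z :&: N x| <= 2.
Proof.
move=> compl; have [ab cd aY bY [cX dX]] := K4_mem.
have covers w : w != z -> w \in X :|: Y.
  by move=> wz; apply: contraR wz; rewrite -in_setC compl inE.
have /norP[zX zY] : ~~ ((z \in X) || (z \in Y)).
  by rewrite -in_setU -in_setC compl inE.
have joined x : x \in X -> ~~ adj z x -> Y \subset N x.
  move=> xX zx; apply: edge_link_join => // y _ _; apply/subsetP=> w.
  rewrite in_L => /andP[xw _]; apply: covers; apply: contraNneq zx => <-.
  by rewrite adj_sym.
have YzY : Y :&: N z != Y.
  apply: contraNneq zX => YzE; rewrite in_L (adj_sym a) (adj_sym b).
  by move: aY bY; rewrite -YzE => /setIP[_ za] /setIP[_ zb]; rewrite -!in_nbh za.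
have XzX : X :&: N z != X.
  apply: contraNneq zY => XzE; rewrite in_L (adj_sym c) (adj_sym d).
  by move: cX dX; rewrite -XzE => /setIP[_ zc] /setIP[_ zd]; rewrite -!in_nbh zc.
(* Otherwise, for a neighbour [y] of [z], the link of [z y] would consist of at most two neighbours
   of [y] on [Y]. *)
have Xz0 : X :&: N z != set0.
  apply/eqP=> Xz0; have noX x : x \in X -> ~~ adj z x.
    by move=> xX; apply/negP=> zx; have := in_set0 x; rewrite -Xz0 in_setI xX in_nbh zx.
  have [/eqP Nz|[y]] := set_0Vmem (N z); first by have := degree_ge6 sphG z; rewrite (eqP Nz) cards0.
  rewrite in_nbh => zy; have yz : y != z by rewrite eq_sym adj_neq.
  have yY : y \in Y.
    by have := covers y yz; rewrite in_setU => /orP[/noX|//]; rewrite zy.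
  have := edge_link_ge4 sphG zy; rewrite leqNgt ltnS -ltnS => /negP; apply.
  apply: (@leq_ltn_trans #|Y :&: N y|); last by rewrite edge_link_degree.
  apply: subset_leq_card; apply/subsetP=> w; rewrite in_L => /andP[zw yw].
  have wz : w != z by rewrite eq_sym adj_neq.
  rewrite in_setI in_nbh yw andbT; have := covers w wz.
  by rewrite in_setU => /orP[/noX|//]; rewrite zw.
have [x1 [x0 [x1X x0X x10 zx1 zx0]]] : exists x1 x0,
    [/\ x1 \in X, x0 \in X, adj x1 x0, adj z x1 & ~~ adj z x0].
  have [/existsP[x1 /existsP[x0 /and5P[]]]|none] :=
    boolP [exists x1, exists x0, [&& x1 \in X, x0 \in X, adj x1 x0, adj z x1 & ~~ adj z x0]].
    by exists x1, x0.
  case/eqP: XzX; apply: (edge_link_connected sphG ab) => //; first exact: subsetIl.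
  move=> x1 x0 /setIP[x1X]; rewrite in_nbh => zx1 x0X x10; rewrite in_setI x0X in_nbh.
  by apply: contraR none => zx0; apply/existsP; exists x1; apply/existsP; exists x0; rewrite x1X x0X x10 zx1.
have Yx1 : Y \subset N x1.
  apply/subsetP=> y yY; have x0y : adj x0 y by rewrite -in_nbh (subsetP (joined x0 x0X zx0)).
  have [|/subsetP sub _] := edge_link_adj_spread x0X yY x0y.
    apply/subsetP=> w; rewrite in_L => /andP[x0w _]; apply: covers.
    by apply: contraNneq zx0 => <-; rewrite adj_sym.
  by rewrite in_nbh adj_sym -in_nbh sub // in_setI x1X in_nbh adj_sym.
have YzL : Y :&: N z \subset L z x1 by rewrite subsetI subsetIr (subset_trans _ Yx1) ?subsetIl.
have [noX|[x2]] := set_0Vmem (X :&: N z :&: N x1); last first.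
  rewrite in_setI in_nbh => /andP[x2Xz x12]; exists x2 => //.
  have zx2 : adj z x2 by move: x2Xz; rewrite in_setI in_nbh => /andP[].
  by rewrite -(triangle_link sphG zx1 zx2 x12); apply: subset_leq_card; rewrite setSI.
(* Without such an [x2] the link of [z x1] is a cycle inside the cycle [Y], hence all of [Y],
   against [YzY]. *)
have LE : L z x1 = Y :&: N z.
  apply/eqP; rewrite eqEsubset YzL andbT; apply/subsetP=> w; rewrite in_L => /andP[zw x1w].
  have wz : w != z by rewrite eq_sym adj_neq.
  have := covers w wz; rewrite in_setU in_setI in_nbh zw andbT => /orP[wX|//].
  suff : w \in X :&: N z :&: N x1 by rewrite noX inE.
  by apply/setIP; rewrite in_nbh x1w; split=> //; apply/setIP; rewrite in_nbh.
case/eqP: YzY; apply: (edge_link_connected sphG cd); first exact: subsetIl.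
  by rewrite -LE -card_gt0; apply: leq_trans (edge_link_ge4 sphG zx1).
move=> y w yYz wY yw; have := edge_link_degree zx1 (x := y); rewrite LE => /(_ yYz) deg2.
have /setIP[yY _] := yYz.
have YyE : Y :&: N z :&: N y = Y :&: N y.
  by apply/eqP; rewrite eqEcard setSI ?subsetIl //= deg2 edge_link_degree.
have : w \in Y :&: N y by apply/setIP; rewrite in_nbh.
by rewrite -YyE => /setIP[].
Qed.

(** With no vertex missed, [edge_link_join] applies to every vertex of the first link. The map is
    built from the join to [G], where injectivity and cardinality suffice, and then inverted. *)
Lemma edge_link_joinable_cover : X :|: Y = setT -> exists2 f : G -> graph_join (link [set a; b]) (link [set c; d]),
  bijective f & forall x y, adj (f x) (f y) = adj x y.
Proof.
move=> cover; pose J := graph_join (link [set a; b]) (link [set c; d]).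
have inX (u : link [set a; b]) : sval u \in X by rewrite /X -links2; exact: valP u.
have inY (u : link [set c; d]) : sval u \in Y by rewrite /Y -links2; exact: valP u.
pose g (u : J) : G := match u with inl v => sval v | inr v => sval v end.
have g_inj : injective g.
  move=> [u|u] [v|v] /= uv; first by congr inl; exact: val_inj.
  - by move/edge_links_disjoint: (inX u); rewrite uv inY.
  - by move/edge_links_disjoint: (inX v); rewrite -uv inY.
  - by congr inr; exact: val_inj.
have g_bij : bijective g.
  apply: inj_card_bij g_inj _; rewrite card_sum !card_sig.
  rewrite -cardsT -cover; apply: leq_trans (leq_card_setU X Y) _.
  by rewrite /X /Y -!links2.
have gadj u v : adj (g u) (g v) = @adj J u v.
  have joined x y : x \in X -> y \in Y -> adj x y.
    move=> xX yY; rewrite -in_nbh; apply: (subsetP (edge_link_join xX _)) yY => w _ _.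
    by rewrite cover subsetT.
  case: u v => [u|u] [v|v] //=; first by rewrite joined.
  by rewrite adj_sym joined.
have [f fK gK] := g_bij; exists f; first by exists g.
by move=> x y; rewrite -gadj !gK.
Qed.

End Split.

Lemma degree_by_cover (X Y : {set G}) z w : z \notin X -> z \notin Y ->
  (forall x, x \in X -> x \notin Y) -> ~: (X :|: Y) = [set z] ->
  #|N w| = #|X :&: N w| + #|Y :&: N w| + adj w z.
Proof.
move=> zX zY XY compl.
rewrite -(cardsID X (N w)) setIC -(cardsID Y (N w :\: X)) addnA; congr (_ + _ + _).
  apply: eq_card => x; rewrite !inE; have := XY x; case: (x \in X) => [/(_ isT)/negPf->|_].
    by rewrite andbF.
  by rewrite andbC.
rewrite setDDl setDE compl; have [wz|wz] := boolP (adj w z); last first.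
  rewrite (_ : _ :&: _ = set0) ?cards0 //; apply/setP=> x; rewrite !inE.
  by apply/negP=> /andP[wx /eqP xz]; rewrite -xz wx in wz.
by rewrite (setIidPr _) ?cards1 // sub1set in_nbh.
Qed.

Lemma degsumD (S T W : {set G}) : T \subset W ->
  degsum S W = degsum S T + degsum S (W :\: T).
Proof.
move=> TW; rewrite /degsum -big_split; apply: eq_bigr => x _ /=.
rewrite -(cardsID T (W :&: N x)); congr (_ + _); apply: eq_card => y; rewrite !inE.
  case yT: (y \in T); rewrite ?andbF ?andbT // (subsetP TW) //=.
by rewrite andbA.
Qed.

(** If [z] has s neighbours on [X] and t on [Y], then m is [#|X|] + [#|Y|] + s + t plus the edges
    across. The boundary vertex on [X] misses at least t - 2 of [Y], the one on [Y] at least s - 2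
    of [X], and one pair may be shared: at least s + t - 5 pairs across are missing. *)
Lemma edges_one_extra_vertex (a b c d z : G) : K4 a b c d ->
  ~: (L a b :|: L c d) = [set z] ->
  #|edges G| <= #|L a b| * #|L c d| + #|L a b| + #|L c d| + 5.
Proof.
move=> K compl; have [ab cd _ _ _] := K4_mem K.
have [x2 x2Xz x2_few] := ex_boundary_vertex K compl.
have compl' : ~: (L c d :|: L a b) = [set z] by rewrite setUC.
have [y2 y2Yz y2_few] := ex_boundary_vertex (K4_swap K) compl'.
set X := L a b in compl compl' x2Xz x2_few y2Yz y2_few *.
set Y := L c d in compl compl' x2Xz x2_few y2Yz y2_few *.
have XY x : x \in X -> x \notin Y by move=> xX; have := edge_links_disjoint K xX.
have /norP[zX zY] : ~~ ((z \in X) || (z \in Y)) by rewrite -in_setU -in_setC compl inE.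
have deg w := degree_by_cover w zX zY XY compl.
have sumV (F : G -> nat) : \sum_(w : G) F w = \sum_(x in X) F x + \sum_(y in Y) F y + F z.
  rewrite (bigID [in X]) /= -addnA; congr (_ + _).
  rewrite (bigID [in Y]) /=; congr (_ + _).
    by apply: eq_bigl => y; have := XY y; case: (y \in X) => // /(_ isT)/negPf->.
  transitivity (\sum_(w in [set z]) F w); last by rewrite big_set1.
  apply: eq_bigl => w.
  by rewrite -negb_or -in_setU -in_setC compl.
have sum_adj_z (S : {set G}) : \sum_(x in S) adj x z = #|S :&: N z|.
  rewrite card_sum_bool big_mkcond; apply: eq_bigr => x _.
  by rewrite in_setI in_nbh adj_sym; case: (x \in S).
have twice : 2 * #|edges G| = (2 * #|X| + degsum X Y + #|X :&: N z|)
    + (degsum X Y + 2 * #|Y| + #|Y :&: N z|) + (#|X :&: N z| + #|Y :&: N z|).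
  rewrite handshake sumV (deg z) adj_irr addn0; congr (_ + _ + _).
    rewrite -sum_adj_z /degsum mulnC -sum_nat_const -!big_split; apply: eq_bigr => x xX.
    by rewrite deg edge_link_degree.
  rewrite [degsum X Y]degsumC -sum_adj_z /degsum [2 * _]mulnC -sum_nat_const -!big_split.
  by apply: eq_bigr => y yY; rewrite deg (edge_link_degree cd yY).
have [x2X _] := setIP x2Xz; have [y2Y _] := setIP y2Yz.
have missing : degsum X Y + (#|X :&: N z| + #|Y :&: N z| - 5) <= #|X| * #|Y|.
  have missX : \sum_(x in X) #|Y :\: N x| + degsum X Y = #|X| * #|Y|.
    rewrite -sum_nat_const /degsum -big_split; apply: eq_bigr => x _.
    by rewrite /= addnC cardsID.
  suff : #|X :&: N z| + #|Y :&: N z| <= \sum_(x in X) #|Y :\: N x| + 5 by rewrite -missX; lia.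
  rewrite (bigD1 x2) //=.
  have le1 : #|Y :&: N z| <= #|Y :\: N x2| + 2.
    rewrite -(cardsID (N x2) (Y :&: N z)) addnC leq_add // subset_leq_card //.
    by rewrite setSD // subsetIl.
  have le2 : #|X :&: N z| <= \sum_(x in X | x != x2) #|Y :\: N x| + 3.
    rewrite -(cardsID (N y2) (X :&: N z)).
    have : #|X :&: N z :\: N y2| <= \sum_(x in X | x != x2) #|Y :\: N x| + 1.
      rewrite (cardsD1 x2) addnC leq_add ?leq_b1 // -sum1_card.
      rewrite big_mkcond [leqRHS]big_mkcond; apply: leq_sum => x _.
      case: ifP => // /setD1P[xx2 /setDP[/setIP[xX _]]]; rewrite in_nbh => y2x.
      rewrite xX xx2 /= card_gt0; apply/set0Pn; exists y2.
      by apply/setDP; rewrite in_nbh adj_sym.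
    lia.
  lia.
lia.
Qed.

End TwoCycles.

(** With one vertex missed the lengths sum to n - 1, and AM-GM gives 4m <= (n - 1)^2 + 4(n - 1) + 20
    = n^2 + 2n + 17, exactly the bound that 4m exceeds. *)
Lemma two_cycles_or_few_edges (G : sgraph) (sphG : spherical_links G) (a b c d : G) :
  K4 a b c d -> #|G| <= #|L a b| + #|L c d| + 1 ->
  #|G| ^ 2 + 2 * #|G| + 17 < 4 * #|edges G| -> L a b :|: L c d = setT.
Proof.
move=> K long large; have XY0 : #|L a b :&: L c d| = 0.
  apply/eqP; rewrite cards_eq0; apply/eqP/setP=> x; rewrite in_setI in_set0.
  by apply/negP=> /andP[/(edge_links_disjoint sphG K)/negP xY /xY].
have cardU : #|L a b :|: L c d| = #|L a b| + #|L c d| by rewrite cardsU XY0 subn0.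
have := cardsC (L a b :|: L c d); rewrite cardU => cardC.
have [C0|C1] : #|~: (L a b :|: L c d)| = 0 \/ #|~: (L a b :|: L c d)| = 1 by lia.
  by apply/setP=> x; have /eqP := C0; rewrite cards_eq0 => /eqP/setP/(_ x); rewrite !inE => /negbFE.
have /eqP/cards1P[z compl] := C1.
have := edges_one_extra_vertex sphG K compl.
move: cardC large; rewrite C1; move: #|L a b| #|L c d| #|edges G| => p q m <-.
have [agm _] := nat_AGM2 p q; rewrite -!mulnn => large few; exfalso.
by move: agm large few; rewrite -mulnn; clear; lia.
Qed.

(** * Adjacency across a partition extending two edge links *)

Definition nonadj (G : sgraph) (S T : {set G}) := \sum_(x in S) #|T :\: N x|.

Section DegreeSums.
Variable G : sgraph.
Implicit Types (x y : G) (S T : {set G}).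

Lemma nonadjC S T : nonadj S T = nonadj T S.
Proof.
transitivity (\sum_(x in S) #|[set y in T | ~~ adj x y]|).
  by apply: eq_bigr => x _; apply: eq_card => y; rewrite !inE andbC.
rewrite double_count; apply: eq_bigr => y _; apply: eq_card => x.
by rewrite !inE adj_sym andbC.
Qed.

Lemma degsum_nonadj S T : degsum S T + nonadj S T = #|S| * #|T|.
Proof.
rewrite -sum_nat_const /degsum -big_split; apply: eq_bigr => x _ /=.
exact: cardsID.
Qed.

Lemma leq_degsum S S' T T' : S \subset S' -> T \subset T' -> degsum S T <= degsum S' T'.
Proof.
move=> SS' TT'; rewrite /degsum [leqRHS](big_setID S) /= (setIidPr SS'); apply: leq_trans (leq_addr _ _).
by apply: leq_sum => x _; rewrite subset_leq_card ?setSI.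
Qed.

Lemma leq_nonadj S S' T T' : S \subset S' -> T \subset T' -> nonadj S T <= nonadj S' T'.
Proof.
move=> SS' TT'; rewrite /nonadj [leqRHS](big_setID S) /= (setIidPr SS').
apply: leq_trans (leq_addr _ _); by apply: leq_sum => x _; rewrite subset_leq_card ?setSD.
Qed.

Lemma degsum_le_mul S T : degsum S T <= #|S| * #|T|.
Proof. by rewrite -degsum_nonadj leq_addr. Qed.

Lemma degsum_remove S T : T \subset S -> degsum S S <= degsum T T + 2 * degsum (S :\: T) S.
Proof.
move=> TS; rewrite (degsumD S TS) [degsum S T]degsumC (degsumD T TS).
rewrite -addnA mul2n -addnn leq_add2l leq_add // degsumC ?leq_degsum //.
Qed.

End DegreeSums.

Section Side.
Variables (G : sgraph) (sphG : spherical_links G) (a b : G) (A : {set G}).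
Hypotheses (ab : adj a b) (subA : L a b \subset A).
Let C := L a b.
Let B := ~: A.
Implicit Types x y c : G.

(** In [A] such a vertex sees just its two neighbours on the cycle, so the link of an edge from it
    to [B] has at most two vertices in [A]. *)
Definition regular := [set c in L a b | A :&: N c \subset L a b].

Lemma card_irregular : #|C :\: regular| <= degsum (A :\: C) C.
Proof.
rewrite degsumC /degsum (big_setID regular) /=; apply: leq_trans (leq_addl _ _).
rewrite -sum1_card; apply: leq_sum => c /setDP[cC].
rewrite in_set [_ \in L a b]cC => /subsetPn[z /setIP[zA cz] zC]; rewrite card_gt0; apply/set0Pn; exists z.
by apply/setIP; split=> //; apply/setDP.
Qed.

(** The cycle [L c x] leaves [B] in at most one vertex, since of the two neighbours of [c] in [A]
    one is [c'], not adjacent to [x]. At least three vertices remain in [B]; some [y1] among them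
    avoids the exceptional vertex, and a neighbour [y2] of [y1] on the cycle is then in [B] too. *)
Lemma triangle_at_transition c c' x : c \in regular -> c' \in C -> adj c c' ->
  x \in B -> adj x c -> ~~ adj x c' -> exists y1 y2,
  [/\ y1 \in B :&: N x, y2 \in B :&: N x :&: N y1 & c \in L x y1 :&: N y2].
Proof.
rewrite in_set => /andP[cC /subsetP creg] c'C cc' xB xc xc'.
have cx : adj c x by rewrite adj_sym.
set O := L c x :\: B; have O1 : #|O| <= 1.
  rewrite -ltnS -(edge_link_degree sphG ab cC); apply: proper_card; apply/properP; split.
    apply/subsetP=> w /setDP[]; rewrite in_L => /andP[cw xw]; rewrite in_setC negbK => wA.
    by apply/setIP; rewrite in_nbh cw creg //; apply/setIP; rewrite in_nbh.
  exists c'; first by apply/setIP; rewrite in_nbh.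
  by apply/setDP=> -[]; rewrite in_L (negPf xc') andbF.
have splitL : #|L c x :&: B| + #|O| = #|L c x| by rewrite cardsID.
have W3 : 3 <= #|L c x :&: B|.
  by have := edge_link_ge4 sphG cx; rewrite -splitL; move: O1; clear; lia.
have [y1 y1W y1O] : exists2 y1, y1 \in L c x :&: B & forall w, w \in O -> ~~ adj y1 w.
  have [O0|[w wO]] := set_0Vmem O.
    have /card_gt0P[y1 y1W] := ltnW (ltnW W3).
    by exists y1 => // w; rewrite O0 inE.
  have OE w' : w' \in O -> w' = w.
    by move=> w'O; apply/eqP; move/card_le1P: O1 => /(_ w wO w'); rewrite w'O inE => /esym.
  have wL : w \in L c x by have /setDP[] := wO.
  have /subsetPn[y1 y1W y1w] : ~~ (L c x :&: B \subset L c x :&: N w).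
    by apply/negP=> /subset_leq_card; rewrite (edge_link_degree sphG cx wL) leqNgt W3.
  exists y1 => // w' /OE->; apply: contra y1w => y1w; apply/setIP.
  by rewrite in_nbh adj_sym y1w; split=> //; have /setIP[] := y1W.
have /setIP[y1L y1B] := y1W; have := y1L; rewrite in_L => /andP[cy1 xy1].
have /card_gt0P[y2 /setIP[y2L]] : 0 < #|L c x :&: N y1| by rewrite (edge_link_degree sphG cx y1L).
rewrite in_nbh => y12; have := y2L; rewrite in_L => /andP[cy2 xy2].
have y2B : y2 \in B by apply: contraTT y12 => y2B; apply: y1O; apply/setDP.
exists y1, y2; split; first by apply/setIP; rewrite in_nbh.
  by apply/setIP; rewrite in_nbh; split=> //; apply/setIP; rewrite in_nbh.
by apply/setIP; rewrite in_L in_nbh xc !(adj_sym _ c) cy1 cy2.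
Qed.

(** Each triangle inside [S] is counted six times. *)
Definition ordered_triangles (S : {set G}) := \sum_(x in S) degsum (S :&: N x) (S :&: N x).

(* A vertex x of B adjacent to f i but not to f (i + 1) spans with two vertices of
   B a triangle whose link contains f i, and the link of a triangle has only two
   vertices. *)
Lemma sum_loss k (f : 'I_k -> G) (E : {set 'I_k}) : injective f ->
  (forall i, i \in E -> [/\ f i \in regular, f (ordS i) \in C & adj (f i) (f (ordS i))]) ->
  \sum_(i in E) #|B :\: L (f i) (f (ordS i))| <= \sum_(i in E) #|B :\: N (f i)| + 2 * ordered_triangles B.
Proof.
move=> f_inj Ereg; pose T i := [set x in B | adj x (f i) && ~~ adj x (f (ordS i))].
apply: (@leq_trans (\sum_(i in E) (#|B :\: N (f i)| + #|T i|))).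
  apply: leq_sum => i _; apply: leq_trans (leq_card_setU _ _); apply: subset_leq_card.
  apply/subsetP=> x /setDP[xB]; rewrite in_L in_setU in_setD in_nbh xB andbT inE xB /=.
  by rewrite !(adj_sym x); case: (adj _ x).
rewrite big_split leq_add2l double_count /ordered_triangles big_distrr; apply: leq_sum => x xB /=.
rewrite /degsum big_distrr /=.
apply: (@leq_trans (\sum_(y1 in B :&: N x) \sum_(y2 in B :&: N x :&: N y1)
   #|[set i in E | f i \in L x y1 :&: N y2]|)).
  rewrite -sum1_card.
  under [leqRHS]eq_bigr do under eq_bigr do rewrite -sum1dep_card big_mkcondr.
  under [leqRHS]eq_bigr do rewrite exchange_big.
  rewrite exchange_big /=; rewrite big_mkcond [leqRHS]big_mkcond; apply: leq_sum => i _.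
  rewrite inE; case: ifP => //= /andP[iE /andP[xi xi']]; rewrite iE.
  have [ireg iC iS] := Ereg i iE.
  have [y1 [y2 [y1B y2B fi]]] := triangle_at_transition ireg iC iS xB xi xi'.
  by rewrite (bigD1 y1) //= (bigD1 y2) //= fi -addnA add1n.
apply: leq_sum => y1 /setIP[y1B]; rewrite in_nbh => xy1.
rewrite mulnC -sum_nat_const; apply: leq_sum => y2 /setIP[/setIP[y2B]]; rewrite !in_nbh => xy2 y12.
rewrite -(triangle_link sphG xy1 xy2 y12) -(card_imset _ f_inj); apply: subset_leq_card.
by apply/subsetP=> c /imsetP[i]; rewrite inE => /andP[_ ?] ->.
Qed.

(** With t neighbours of [z] on the cycle and at most r in [A] off it, the adjacent pairs on the
    cycle number at most 2t and the others at most 2r (t + r). *)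
Lemma degsum_nbh_extra z r : #|A :\: C| <= r ->
  degsum (A :&: N z) (A :&: N z) <= 2 * (r + 1) * #|C :&: N z| + 2 * r ^ 2.
Proof.
move=> Zr; have sub : C :&: N z \subset A :&: N z by rewrite setSI.
have ZzE : (A :&: N z) :\: (C :&: N z) \subset A :\: C.
  apply/subsetP=> x /setDP[/setIP[xA xz] /negP xC]; apply/setDP; split=> //.
  by apply/negP=> xC'; apply: xC; apply/setIP.
have Zz_r := leq_trans (subset_leq_card ZzE) Zr.
apply: leq_trans (degsum_remove sub) _.
have le1 : degsum (C :&: N z) (C :&: N z) <= 2 * #|C :&: N z|.
  rewrite mulnC -sum_nat_const; apply: leq_sum => x /setIP[xC _].
  by rewrite -(edge_link_degree sphG ab xC) subset_leq_card ?setSI ?subsetIl.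
have le2 := degsum_le_mul ((A :&: N z) :\: (C :&: N z)) (A :&: N z).
have cardA : #|A :&: N z| <= #|C :&: N z| + r.
  by rewrite -(cardsID (C :&: N z) (A :&: N z)) leq_add ?subset_leq_card ?subsetIr.
have le3 := leq_trans le2 (leq_mul Zz_r cardA).
move: le1 le3; move: (degsum _ _) (degsum _ _) #|_ :&: _| => p q t.
by clear; rewrite -mulnn; lia.
Qed.

Lemma no_triangle_in_edge_link x : x \in C -> degsum (C :&: N x) (C :&: N x) = 0.
Proof.
rewrite in_L => /andP[ax bx]; apply: big1 => y yCx; apply/eqP; rewrite cards_eq0.
apply/eqP/setP=> w; rewrite in_set0; apply/negP=> /setIP[wCx]; rewrite in_nbh; apply/negP.
exact: (no_K5 sphG ab ax bx).
Qed.

(** No triangle lies on the cycle. [T] counts the ordered triangles whose first vertex is off it;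
    those with second or third vertex off it number [T] each, whence the factor 3. *)
Lemma ordered_triangles_le r : #|A :\: C| <= r ->
  ordered_triangles A <= 3 * (2 * (r + 1) * degsum (A :\: C) C + 2 * r ^ 3).
Proof.
move=> Zr; set Z := A :\: C; pose T := \sum_(z in Z) degsum (A :&: N z) (A :&: N z).
have TP : T <= 2 * (r + 1) * degsum Z C + 2 * r ^ 3.
  apply: (@leq_trans (\sum_(z in Z) (2 * (r + 1) * #|C :&: N z| + 2 * r ^ 2))).
    by apply: leq_sum => z _; apply: degsum_nbh_extra.
  rewrite big_split -big_distrr sum_nat_const leq_add2l mulnCA leq_mul2l /=.
  by rewrite [leqRHS]expnS leq_mul2r Zr orbT.
apply: leq_trans (leq_mul (leqnn 3) TP); rewrite mulSn.
rewrite /ordered_triangles (big_setID C) /= (setIidPr subA) -/Z -/T addnC leq_add2l.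
apply: (@leq_trans (\sum_(x in C) \sum_(z in Z | adj x z) 2 * #|A :&: N z :&: N x|)).
  apply: leq_sum => x xC; rewrite -big_distrr /=.
  have sub : C :&: N x \subset A :&: N x by rewrite setSI.
  apply: leq_trans (degsum_remove sub) _; rewrite no_triangle_in_edge_link // add0n.
  rewrite leq_mul2l /degsum (eq_bigl (fun z => (z \in Z) && adj x z)).
    by apply: leq_sum => z _; rewrite setIAC.
  move=> z; rewrite !inE; case: (adj x z); rewrite ?andbT ?andbF //.
under eq_bigr do rewrite big_mkcondr; rewrite exchange_big /T big_distrr.
apply: leq_sum => z zZ; rewrite -big_mkcondr -big_distrr leq_mul2l /degsum /=.
rewrite (eq_bigl [in C :&: N z]).
  have sub : C :&: N z \subset A :&: N z by rewrite setSI.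
  by rewrite [leqRHS](big_setID (C :&: N z)) /= (setIidPr sub) leq_addr.
by move=> x; rewrite in_setI in_nbh adj_sym.
Qed.

End Side.

(** Were all sums at least 2, the totals s and t would satisfy 2 [#|E|] [#|F|] <= [#|F|] s + [#|E|]
    t; multiplying by [k], a lower bound of both sizes, gives s + t >= 2k. *)
Lemma ex_pair_small_sum (I J : finType) (E : {set I}) (F : {set J})
    (l : I -> nat) (l' : J -> nat) k :
  k <= #|E| -> k <= #|F| -> \sum_(i in E) l i + \sum_(j in F) l' j < 2 * k ->
  exists i j, [/\ i \in E, j \in F & l i + l' j <= 1].
Proof.
move=> kE kF small.
have [/existsP[i /existsP[j /and3P[]]]|none] :=
  boolP [exists i, exists j, [&& i \in E, j \in F & l i + l' j <= 1]]; first by exists i, j.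
have : \sum_(i in E) \sum_(j in F) 2 <= \sum_(i in E) \sum_(j in F) (l i + l' j).
  apply: leq_sum => i iE; apply: leq_sum => j jF; rewrite ltnNge; apply: contra none => le1.
  by apply/existsP; exists i; apply/existsP; exists j; rewrite iE jF.
under [leqRHS]eq_bigr do rewrite big_split sum_nat_const.
rewrite big_split -big_distrr !sum_nat_const /=; move: small kE kF.
move: (\sum_(i in E) _) (\sum_(j in F) _) #|E| #|F| => s t p q; clear.
move=> small kp kq le; exfalso; move: le; apply/negP; rewrite -ltnNge.
have [p0|p_gt0] := posnP p; first by lia.
have [q0|q_gt0] := posnP q; first by lia.
have k_gt0 : 0 < k by lia.
rewrite -(ltn_pmul2l k_gt0); apply: (@leq_ltn_trans (p * q * (s + t))).
  have h1 : k * q * s <= p * q * s by rewrite !leq_mul.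
  have h2 : k * p * t <= q * p * t by rewrite !leq_mul.
  lia.
have -> : k * (p * (q * 2)) = p * q * (2 * k) by lia.
by rewrite ltn_pmul2l // muln_gt0 p_gt0.
Qed.

Section BothSides.
Variables (G : sgraph) (sphG : spherical_links G) (a b c d : G) (A : {set G}).
Hypotheses (Kabcd : K4 a b c d) (subA : L a b \subset A) (subB : L c d \subset ~: A).
Let C := L a b.
Let D := L c d.
Let B := ~: A.
Let Cr := regular a b A.
Let Dr := regular c d B.
Implicit Types x y : G.

Lemma regular_spread x y : x \in Cr -> y \in Dr -> adj x y -> D :&: N y \subset N x.
Proof.
move=> /setIdP[xC /subsetP xr] /setIdP[yD /subsetP yr] xy.
have [|//] := edge_link_adj_spread sphG Kabcd xC yD xy.
apply/subsetP=> w; rewrite in_L => /andP[xw yw]; rewrite in_setU.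
have [wA|wA] := boolP (w \in A); first by rewrite xr //; apply/setIP; rewrite in_nbh.
by rewrite yr ?orbT //; apply/setIP; rewrite in_nbh in_setC.
Qed.

Variables (q : nat) (g : 'I_q -> G).
Hypotheses (g_inj : injective g) (gD : [set g j | j : 'I_q] = D).
Hypothesis gS : forall j, adj (g j) (g (ordS j)).

(** Starts of runs of ten regular vertices; the length makes each failure of adjacency cost ten
    pairs. *)
Definition window : {set 'I_q} := [set j | [forall t : 'I_10, g (iter t (@ordS q) j) \in Dr]].

Definition dominating : {set G} := [set x in Cr | [forall j in window, adj x (g j)]].

Lemma mem_cycle j : g j \in D.
Proof. by rewrite -gD imset_f. Qed.

Lemma card_not_window : #|~: window| <= 10 * #|D :\: Dr|.
Proof.
apply: (@leq_trans (\sum_j \sum_(t < 10) (g (iter t (@ordS q) j) \notin Dr))).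
  rewrite card_sum_bool; apply: leq_sum => j _; rewrite in_setC inE.
  case: forallP => //= /forallP; rewrite negb_forall => /existsP[t jt].
  by rewrite (bigD1 t) //= jt.
rewrite exchange_big -[10 in leqRHS]card_ord -sum_nat_const; apply: leq_sum => t _ /=.
have inj_t : injective (fun j => g (iter t (@ordS q) j)).
  by move=> j j' /g_inj; elim: (nat_of_ord t) => //= s IH /ordS_inj.
rewrite (_ : \sum_j _ = #|[set j | g (iter t (@ordS q) j) \notin Dr]|); last first.
  by rewrite card_sum_bool; apply: eq_bigr => j _; rewrite inE.
rewrite -(card_imset _ inj_t); apply: subset_leq_card; apply/subsetP=> y /imsetP[j].
by rewrite inE => jr ->; apply/setDP; rewrite mem_cycle.
Qed.

(** Non-adjacency propagates forward along the run: if [x] were adjacent to the next vertex, which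
    is regular, [regular_spread] would make it adjacent to the previous one. *)
Lemma regular_not_dominating x j : 10 <= q -> x \in Cr -> j \in window ->
  ~~ adj x (g j) -> 10 <= #|D :\: N x|.
Proof.
move=> q10 xr; rewrite inE => /forallP jw xj.
have miss t : t < 10 -> ~~ adj x (g (iter t (@ordS q) j)).
  elim: t => [//|t IH] t10; apply: contra (IH (ltnW t10)) => xt.
  have := subsetP (regular_spread xr (jw (Ordinal t10)) xt) (g (iter t (@ordS q) j)).
  rewrite in_nbh; apply; apply/setIP; rewrite mem_cycle in_nbh adj_sym; split=> //.
have inj_t : injective (fun t : 'I_10 => g (iter t (@ordS q) j)).
  move=> t t' /g_inj /(congr1 val) /eqP; rewrite /= !val_iter_ordS eqn_modDl.
  have lt10 (s : 'I_10) : s < q by apply: leq_trans (ltn_ord s) q10.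
  by rewrite !modn_small // => /eqP/val_inj.
rewrite -[10]card_ord -(card_imset _ inj_t); apply: subset_leq_card.
by apply/subsetP=> y /imsetP[t _ ->]; apply/setDP; rewrite mem_cycle in_nbh miss.
Qed.

Lemma card_regular_not_dominating : 10 <= q -> 10 * #|Cr :\: dominating| <= nonadj A B.
Proof.
move=> q10; rewrite mulnC -sum_nat_const.
apply: (@leq_trans (nonadj (Cr :\: dominating) D)).
  apply: leq_sum => x /setDP[xr]; rewrite inE xr /= negb_forall_in => /exists_inP[j jw xj].
  exact: regular_not_dominating jw xj.
apply: leq_nonadj => //; apply/subsetP=> x /setDP[xr _]; apply: (subsetP subA).
by case/setIdP: xr.
Qed.

Lemma card_not_dominating : 10 <= q ->
  10 * #|C :\: dominating| <= 10 * degsum (A :\: C) C + nonadj A B.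
Proof.
move=> q10; apply: leq_trans (leq_add (leqnn _) (card_regular_not_dominating q10)).
rewrite -mulnDr leq_mul2l /=; apply: leq_trans (leq_add (card_irregular a b A) (leqnn _)).
apply: leq_trans (leq_card_setU _ _); apply: subset_leq_card; apply/subsetP=> x /setDP[xC xd].
by rewrite in_setU !in_setD xC xd andbT; case: (x \in regular _ _ _).
Qed.

(** No pair is counted in both sums: a dominating vertex has all its non-neighbours in [B] outside
    [W]. *)
Lemma nonadj_dominating :
  \sum_(x in dominating) #|B :\: N x| + \sum_(j in window) #|A :\: N (g j)| <= nonadj A B.
Proof.
pose W := [set g j | j in window]; have domA : dominating \subset A.
  by apply/subsetP=> x /setIdP[/setIdP[xC _] _]; apply: (subsetP subA).
have WB : W \subset B.
  by apply/subsetP=> y /imsetP[j _ ->]; apply: (subsetP subB); exact: mem_cycle.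
have -> : \sum_(j in window) #|A :\: N (g j)| = nonadj A W.
  by rewrite nonadjC /nonadj big_imset //= => j j' _ _; exact: g_inj.
have -> : nonadj A B = nonadj A W + nonadj A (B :\: W).
  rewrite /nonadj -big_split; apply: eq_bigr => x _ /=; rewrite -(cardsID W (B :\: N x)).
  congr (_ + _); apply: eq_card => y; rewrite ?in_setI !in_setD; last by rewrite andbCA.
  by case yW: (y \in W); rewrite ?andbF ?andbT // (subsetP WB) ?andbT.
rewrite addnC leq_add2l; apply: leq_trans (leq_nonadj domA (subxx _)).
apply: leq_sum => x /setIdP[_ /forall_inP xW]; apply: subset_leq_card.
apply/subsetP=> y /setDP[yB xy]; apply/setDP; split=> //; apply/setDP; split=> //.
by apply: contra xy => /imsetP[j jw ->]; rewrite in_nbh xW.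
Qed.

End BothSides.

(** * Improving the K4 *)

Lemma card_consecutive k (I : {set 'I_k}) :
  k <= #|[set i | (i \in I) && (ordS i \in I)]| + 2 * #|~: I|.
Proof.
set E := [set i | _]; have kE : k = #|E| + #|~: E| by rewrite cardsC card_ord.
rewrite [leqLHS]kE leq_add2l mul2n -addnn.
apply: (@leq_trans (#|~: I| + #|@ordS k @^-1: ~: I|)); last first.
  by rewrite card_preimset //; exact: ordS_inj.
apply: leq_trans (leq_card_setU _ _); apply: subset_leq_card.
by apply/subsetP=> i; rewrite !inE negb_and.
Qed.

(** AM-GM on the part sizes [alpha], [beta] bounds the nonadjacent pairs [M]. If [alpha] were below
    0.49n, then t = [beta] - [alpha] would be at least n / 50, while t^2 = n^2 - 4 [alpha] [beta] <=
    3n; so t <= 150, too small for n. *)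
Lemma balanced_parts (alpha beta n m M p q zeta : nat) :
  alpha + beta = n -> p + q <= n -> 8 * zeta <= n -> 1000 * 100 <= n ->
  m + M <= alpha * beta + (p + q) + zeta + 2 * 49 ^ 2 ->
  n ^ 2 + 2 * n + 17 < 4 * m ->
  2 * M <= n + 2 * zeta + 4 * 49 ^ 2 /\ 49 * n <= 100 * alpha.
Proof.
move=> <- {n}; rewrite -!mulnn => pq ze big le large.
have agm := (nat_AGM2 alpha beta).1; rewrite -mulnn in agm; split; first by lia.
rewrite leqNgt; apply/negP=> small.
clear agm; have [t tE] : exists t, beta = alpha + t by exists (beta - alpha); lia.
move: pq ze big le large small; rewrite {beta}tE => pq ze big le large small.
have t2 : t * t <= 3 * (alpha + (alpha + t)) by lia.
have t50 : alpha + (alpha + t) <= 50 * t by lia.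
have : 50 * (t * t) <= 150 * (50 * t) by lia.
have t_gt0 : 0 < t by lia.
rewrite !mulnA leq_pmul2r //; lia.
Qed.

Lemma small_of_product (n K x y : nat) :
  53 * K ^ 2 <= n -> x <= y -> x * y <= 53 * n -> K * x <= n.
Proof.
move=> Kn xy xyn; rewrite -leq_sqr expnMn; have [n0|n_gt0] := posnP n.
  by move: xyn; rewrite n0 muln0; have := leq_mul (leqnn x) xy; rewrite mulnn => h1 h2; nia.
apply: (@leq_trans (K ^ 2 * (53 * n))).
  by rewrite leq_mul2l -mulnn (leq_trans (leq_mul (leqnn x) xy)) ?orbT.
by rewrite mulnA -[n ^ 2]mulnn leq_mul2r mulnC Kn orbT.
Qed.

(** In orders of magnitude: [M] is at most about n/2 and the extra degrees [zA], [zB] are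
    negligible. So [nI] is at most about n/20 and [E] at least about 0.39n > n/3, while the losses
    [S1 + S2] stay near 0.56n < 2n/3. *)
Lemma index_sets_large (n alpha beta M p q zA zB tA tB E F nI nW S1 S2 S3 S4 : nat) :
  alpha + beta = n -> 1000 * (1000 * 1000) <= n -> 100 * 100 * (zA + zB) <= n ->
  2 * M <= n + 2 * (zA + zB) + 4 * 49 ^ 2 -> 49 * n <= 100 * alpha -> 49 * n <= 100 * beta ->
  alpha <= p + 49 -> beta <= q + 49 ->
  p <= E + 2 * nI -> q <= F + 2 * nW -> 10 * nI <= 10 * zA + M -> nW <= 10 * zB ->
  tA <= 3 * (2 * (49 + 1) * zA + 2 * 49 ^ 3) -> tB <= 3 * (2 * (49 + 1) * zB + 2 * 49 ^ 3) ->
  S1 <= S3 + 2 * tB -> S2 <= S4 + 2 * tA -> S3 + S4 <= M ->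
  [/\ n %/ 3 <= E, n %/ 3 <= F & S1 + S2 < 2 * (n %/ 3)].
Proof. by rewrite -!mulnn !expnS expn0; split; lia. Qed.

Section Improve.
Variables (G : sgraph) (sphG : spherical_links G) (a b c d : G).
Hypothesis Kabcd : K4 a b c d.
Let C := L a b.
Let D := L c d.
Implicit Types x y z : G.

Section Partition.
Variable A : {set G}.
Hypotheses (subA : C \subset A) (subB : D \subset ~: A).
Let B := ~: A.

Lemma edges_by_parts :
  #|edges G| + nonadj A B <= #|A| * #|B| + (#|C| + #|D|)
    + (degsum (A :\: C) A + degsum (B :\: D) B).
Proof.
have [ab cd _ _ _] := K4_mem Kabcd.
have twice : 2 * #|edges G| = degsum A A + 2 * degsum A B + degsum B B.
  transitivity (degsum [set: G] [set: G]).
    rewrite handshake; apply: eq_big => [x|x _]; rewrite ?inE //.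
    by rewrite setTI.
  have part S : degsum S [set: G] = degsum S A + degsum S B.
    by rewrite (degsumD S (subsetT A)) setTD.
  by rewrite part [degsum _ A]degsumC [degsum setT B]degsumC !part [degsum B A]degsumC; lia.
have CC : degsum C C = 2 * #|C|.
  by rewrite mulnC -sum_nat_const; apply: eq_bigr => x; exact: edge_link_degree.
have DD : degsum D D = 2 * #|D|.
  by rewrite mulnC -sum_nat_const; apply: eq_bigr => x; exact: edge_link_degree.
have := degsum_remove subA; have := degsum_remove subB; have := degsum_nonadj A B.
by rewrite -/B -/C -/D CC DD; move: twice; lia.
Qed.

End Partition.

(** Adjacent pairs between the neighbours of [z] on the two cycles are edges of the link of [z],
    which has fewer than 3n edges by Euler's formula. *)
Lemma product_of_degrees z : #|C :&: N z| * #|D :&: N z| <= 3 * #|G| + nonadj C D.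
Proof.
have := degsum_nonadj (C :&: N z) (D :&: N z).
have le1 := leq_nonadj (subsetIl C (N z)) (subsetIl D (N z)).
have le2 : 2 * degsum (C :&: N z) (D :&: N z) <= degsum (N z) (N z).
  rewrite [leqRHS](big_setID C) /= mul2n -addnn leq_add //.
    by rewrite setIC; apply: leq_degsum; rewrite ?subsetIl ?subsetIr.
  rewrite degsumC; apply: leq_degsum; last exact: subsetIr.
  apply/subsetP=> y /setIP[yD yz]; apply/setDP; split=> //.
  exact (edge_links_disjoint sphG (K4_swap Kabcd) yD).
have dG : #|N z| <= #|G| by exact: max_card.
have := link_euler_eq z sphG; move: le1 le2 dG.
move: (degsum _ _) (degsum _ _) (nonadj _ _) (nonadj _ _) #|N z| #|G|.
by clear; lia.
Qed.

Section Improvement.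
Variable K : nat.
Hypotheses (K_large : 490 * 1000 <= K) (G_large : 53 * K ^ 2 <= #|G|).
Hypothesis long : #|G| <= #|C| + #|D| + 49.
Hypothesis dense : #|G| ^ 2 + 2 * #|G| + 17 < 4 * #|edges G|.

(** A vertex off both cycles goes to the side whose cycle has no more of its neighbours;
    [product_of_degrees] keeps that number small. *)
Let A := C :|: [set z in ~: D | #|C :&: N z| <= #|D :&: N z|].
Let B := ~: A.

Lemma part_subA : C \subset A.
Proof. exact: subsetUl. Qed.

Lemma part_subB : D \subset B.
Proof.
apply/subsetP=> x xD; rewrite in_setC in_setU negb_or.
rewrite (edge_links_disjoint sphG (K4_swap Kabcd) xD) in_set negb_and in_setC xD.
by [].
Qed.

Lemma card_parts : #|A| + #|B| = #|G|.
Proof. exact: cardsC. Qed.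

Lemma card_extra : #|A :\: C| + #|B :\: D| <= 49.
Proof.
have := cardsID C A; have := cardsID D B; rewrite (setIidPr part_subA) (setIidPr part_subB).
by have := card_parts; move: long; lia.
Qed.

Lemma degsum_extra (S T : {set G}) : T \subset S -> #|S :\: T| <= 49 ->
  degsum (S :\: T) S <= degsum (S :\: T) T + 49 ^ 2.
Proof.
move=> TS S49; rewrite (degsumD _ TS) leq_add2l -mulnn.
by apply: leq_trans (degsum_le_mul _ _) _; apply: leq_mul.
Qed.

Let M := nonadj A B.

Lemma edges_bound : #|edges G| + M <= #|A| * #|B| + (#|C| + #|D|)
  + (degsum (A :\: C) C + degsum (B :\: D) D) + 2 * 49 ^ 2.
Proof.
have := edges_by_parts part_subA part_subB; have card49 := card_extra.
have leA := degsum_extra part_subA (leq_trans (leq_addr _ _) card49).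
have leB := degsum_extra part_subB (leq_trans (leq_addl _ _) card49).
by move: leA leB; rewrite -/B -/M; clear; lia.
Qed.

(** As [#|A| * #|B|] <= n^2 / 4 < m, the edge count leaves at most n + 49n nonadjacent pairs. *)
Lemma crude_nonadj : nonadj C D <= 50 * #|G|.
Proof.
have := edges_by_parts part_subA part_subB; rewrite -/B.
have le1 : degsum (A :\: C) A + degsum (B :\: D) B <= 49 * #|G|.
  apply: leq_trans (leq_add (degsum_le_mul _ _) (degsum_le_mul _ _)) _.
  apply: (@leq_trans (#|A :\: C| * #|G| + #|B :\: D| * #|G|)).
    by rewrite leq_add // leq_mul2l max_card orbT.
  by rewrite -mulnDl leq_mul2r card_extra orbT.
have le2 : #|C| + #|D| <= #|G|.
  by rewrite -card_parts leq_add ?subset_leq_card ?part_subA ?part_subB.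
have le3 := leq_nonadj part_subA part_subB.
have := (nat_AGM2 #|A| #|B|).1; rewrite card_parts; move: dense.
by move: le1 le2 le3; rewrite -!mulnn; lia.
Qed.

(** Here 53 = 3 + 50, from the two preceding bounds. Each of the at most 49 extra vertices has at
    most n / K neighbours on the cycle of its side, and 49 / K <= 1 / 10^4. *)
Lemma small_extra_degrees :
  100 * 100 * (degsum (A :\: C) C + degsum (B :\: D) D) <= #|G|.
Proof.
have prod z : #|C :&: N z| * #|D :&: N z| <= 53 * #|G|.
  by apply: leq_trans (product_of_degrees z) _; have := crude_nonadj; lia.
have leA : K * degsum (A :\: C) C <= #|A :\: C| * #|G|.
  rewrite big_distrr -sum_nat_const; apply: leq_sum => z /setDP[].
  rewrite in_setU in_set => /orP[->//|/andP[_ le]] _.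
  exact: small_of_product G_large le (prod z).
have leB : K * degsum (B :\: D) D <= #|B :\: D| * #|G|.
  rewrite big_distrr -sum_nat_const; apply: leq_sum => z /setDP[].
  rewrite in_setC in_setU in_set negb_or in_setC => /andP[_ +] zD; rewrite zD /= -ltnNge => lt.
  by apply: small_of_product G_large (ltnW lt) _; rewrite mulnC.
have le49 : K * (degsum (A :\: C) C + degsum (B :\: D) D) <= 49 * #|G|.
  rewrite mulnDr; apply: leq_trans (leq_add leA leB) _.
  by rewrite -mulnDl leq_mul2r card_extra orbT.
have := leq_trans (leq_mul K_large (leqnn _)) le49.
by move: (_ + _) #|G|; clear; lia.
Qed.

(** An edge of the first cycle with dominating ends and an edge of the second with ends in [W] span
    a K4. It misses at most the vertices of [B] outside the link of the first and those of [A]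
    outside the link of the second; on average these are fewer than 2. *)
Lemma ex_better_K4 : exists a' b' c' d' : G,
  K4 a' b' c' d' /\ #|G| <= #|L a' b'| + #|L c' d'| + 1.
Proof.
have [ab cd _ _ _] := K4_mem Kabcd; have BB : ~: B = A by rewrite setCK.
have [p [f [f_inj fC fS]]] := edge_link_cycle sphG ab.
have [q [g [g_inj gD gS]]] := edge_link_cycle sphG cd.
have pE : #|C| = p by rewrite -[C]fC card_imset // card_ord.
have qE : #|D| = q by rewrite -[D]gD card_imset // card_ord.
have n_big : 1000 * (1000 * 1000) <= #|G|.
  apply: leq_trans G_large; apply: (@leq_trans (1 * ((490 * 1000) * (490 * 1000)))).
    by rewrite mul1n; lia.
  by rewrite -mulnn; apply: leq_mul => //; apply: leq_mul.
have zeta := small_extra_degrees; have card49 := card_extra.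
have zeta8 : 8 * (degsum (A :\: C) C + degsum (B :\: D) D) <= #|G| by move: zeta; lia.
have pqn : #|C| + #|D| <= #|G|.
  by rewrite -card_parts leq_add ?subset_leq_card ?part_subA ?part_subB.
have n_big' : 1000 * 100 <= #|G| by move: n_big; lia.
have [M_small A_big] := balanced_parts card_parts pqn zeta8 n_big' edges_bound dense.
have cardBA : #|B| + #|A| = #|G| by rewrite addnC card_parts.
have edgesBA := edges_bound; rewrite [#|A| * _]mulnC in edgesBA.
have [_ B_big] := balanced_parts cardBA pqn zeta8 n_big' edgesBA dense.
have A_le : #|A| <= p + 49.
  rewrite -pE -(cardsID C A) (setIidPr part_subA) leq_add2l.
  exact: leq_trans (leq_addr _ _) card49.
have B_le : #|B| <= q + 49.
  rewrite -qE -(cardsID D B) (setIidPr part_subB) leq_add2l.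
  exact: leq_trans (leq_addl _ _) card49.
have q10 : 10 <= q by move: B_le B_big n_big; clear; lia.
pose dom := dominating a b c d A g; pose W := window c d A g.
pose I := [set i | f i \in dom].
have E_le := card_consecutive I; have F_le := card_consecutive W.
set E := [set i | _] in E_le; set F := [set j | _] in F_le.
have I_le : #|~: I| <= #|C :\: dom|.
  rewrite -(card_imset _ f_inj); apply: subset_leq_card; apply/subsetP=> x /imsetP[i].
  by rewrite in_setC in_set => iI ->; apply/setDP; split=> //; rewrite -[C]fC imset_f.
have dom_le := card_not_dominating sphG Kabcd part_subA part_subB g_inj gD gS q10.
have W_le := card_not_window A g_inj gD.
have irr_le := card_irregular c d B; rewrite -/D in irr_le.
have triA := ordered_triangles_le sphG ab part_subA (leq_trans (leq_addr _ _) card49).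
have triB := ordered_triangles_le sphG cd part_subB (leq_trans (leq_addl _ _) card49).
have total := nonadj_dominating part_subA part_subB g_inj gD.
have E_reg i : i \in E -> [/\ f i \in regular a b A, f (ordS i) \in C & adj (f i) (f (ordS i))].
  rewrite [i \in E]in_set [i \in I]in_set [ordS i \in I]in_set.
  by case/andP=> /setIdP[ir _] /setIdP[/setIdP[iC _] _].
have lossE := sum_loss sphG ab f_inj E_reg.
have F_reg j : j \in F -> [/\ g j \in regular c d B, g (ordS j) \in D & adj (g j) (g (ordS j))].
  case/setIdP=> jW _; split; rewrite ?(mem_cycle gD) //.
  by move: jW; rewrite [j \in W]in_set => /forallP/(_ ord0).
have lossF := sum_loss sphG cd g_inj F_reg; rewrite BB in lossF.
have sumE : \sum_(i in E) #|B :\: N (f i)| <= \sum_(x in dom) #|B :\: N x|.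
  rewrite -[leqLHS](big_imset (fun x => #|B :\: N x|) (h := f) (A := [in E])) /=; last by move=> ? ? _ _; exact: f_inj.
  apply: (leq_nonadj (S := [set f i | i in E])) => //; apply/subsetP=> x /imsetP[i].
  by rewrite [i \in E]in_set [i \in I]in_set => /andP[+ _] ->.
have sumF : \sum_(j in F) #|A :\: N (g j)| <= \sum_(j in W) #|A :\: N (g j)|.
  rewrite [leqRHS](big_setID F) /=; apply: leq_trans (leq_addr _ _).
  by rewrite (setIidPr _) //; apply/subsetP=> j /setIdP[].
have [kE kF small] : [/\ #|G| %/ 3 <= #|E|, #|G| %/ 3 <= #|F| &
  \sum_(i in E) #|B :\: L (f i) (f (ordS i))| + \sum_(j in F) #|A :\: L (g j) (g (ordS j))|
    < 2 * (#|G| %/ 3)].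
  apply: (index_sets_large card_parts n_big zeta M_small A_big B_big A_le B_le E_le F_le _ _ triA triB
    lossE lossF).
  - apply: leq_trans dom_le; by rewrite leq_mul2l I_le.
  - by apply: leq_trans W_le _; rewrite leq_mul2l irr_le.
  by apply: leq_trans total; rewrite leq_add.
have [i [j [iE jF le1]]] := ex_pair_small_sum kE kF small.
exists (f i), (f (ordS i)), (g j), (g (ordS j)); split.
  case/setIdP: jF => jW jW'; move: iE.
  rewrite [i \in E]in_set [i \in I]in_set [ordS i \in I]in_set => /andP[].
  case/setIdP=> _ /forall_inP domi /setIdP[_ /forall_inP domi'].
  by rewrite /K4 fS gS !domi ?domi'.
have lA : #|A| <= #|L (g j) (g (ordS j))| + #|A :\: L (g j) (g (ordS j))|.
  by rewrite -(cardsID (L (g j) (g (ordS j))) A) leq_add2r subset_leq_card ?subsetIr.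
have lB : #|B| <= #|L (f i) (f (ordS i))| + #|B :\: L (f i) (f (ordS i))|.
  by rewrite -(cardsID (L (f i) (f (ordS i))) B) leq_add2r subset_leq_card ?subsetIr.
by have := card_parts; move: lA lB le1; clear; lia.
Qed.

End Improvement.
End Improve.

(** * From the edge bound to the join of two cycles *)

Lemma fascinating_link_cycle (R : realType) (G : sgraph) (x y : G) :
  fascinating R G -> adj x y -> is_cycle (link [set x; y]).
Proof. by case=> _ elk _ _ /edgesP/elk[k _ ?]; exists k. Qed.

Import GRing.Theory Num.Theory.
Local Open Scope ring_scope.

Lemma natural_edge_bound (n m : nat) :
  1 / 4 * (n%:R ^+ 2 + 2 * n%:R + 17) < m%:R :> rat -> (n ^ 2 + 2 * n + 17 < 4 * m)%N.
Proof.
have sE : (n ^ 2 + 2 * n + 17)%:R = n%:R ^+ 2 + 2 * n%:R + 17 :> rat.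
  by rewrite -natrX -natrM -!natrD.
by rewrite -(ltr_nat rat) sE natrM; lra.
Qed.

Theorem theorem1p6 (R : realType) :
  exists n0 : nat, forall G : sgraph,
    fascinating R G ->
    (n0 <= #|G|)%N ->
    1 / 4 * (#|G|%:R ^+ 2 + 2 * #|G|%:R + 17) < #|edges G|%:R :> rat ->
    exists H1 H2 : sgraph,
      [/\ is_cycle H1, is_cycle H2 & graph_iso G (graph_join H1 H2)].
Proof.
(* [K] is kept abstract, so that the threshold is never computed as a unary number. *)
have [K K_large] : exists K, (490 * 1000 <= K)%N by eexists; exact: leqnn.
exists (53 * K ^ 2)%N => G fG G_large /natural_edge_bound dense.
have sphG := fascinating_spherical_links fG.
have [a [b [c [d [Kabcd long]]]]] := ex_K4_long_links sphG dense.
have [x [y [z [w [Kxyzw almost]]]]] := ex_better_K4 sphG Kabcd K_large G_large long dense.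
have cover := two_cycles_or_few_edges sphG Kxyzw almost dense.
have [xy zw _ _ _] := K4_mem Kxyzw.
exists (link [set x; y]%SET), (link [set z; w]%SET); split.
- exact: fascinating_link_cycle fG xy.
- exact: fascinating_link_cycle fG zw.
- exact: edge_link_joinable_cover.
Qed.
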